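(* Let $\ell=v_\pi(2)$. Let $Q=\bigoplus_{i\in\mathbb N}\pi^iQ_i\oplus L+c$, where each $Q_i$ is a unimodular quadratic form of rank $r_i$ over $R$, there is a positive integer $\omega$ with $Q_i=0$ for $i>\omega$, $L$ is a linear form involving at most one indeterminate (all in disjoint variables), and $c\in R$. Define $Q_{(j)}=\bigoplus_{0\le i\le j,\ i\equiv j\ (\mathrm{mod}\ 2)}Q_i$, $r_{(j)}=\sum_{0\le i\le j,\ i\equiv j\ (\mathrm{mod}\ 2)}r_i$, $q_{(j)}=q^{\sum_{0\le i<j}r_{(i)}}$, and for a quadratic form $P$ let $G_P$ be its $p$-adic generating function and $H_P$ its head. (1) If $L=0$, then $$G_Q(z)=\sum_{0\le i<\omega-1}\frac{z^c}{q_{(i)}}H_{Q_{(i)}}(z^{\pi^i})G_{Q_{(i+1)}}(z^{\pi^{i+1}})\prod_{2\le j\le2\ell}G_{Q_{i+j}}(z^{\pi^{i+j}})+\frac{z^c}{q_{(\omega-1)}}G_{Q_{(\omega-1)}}(z^{\pi^{\omega-1}})G_{Q_{(\omega)}}(z^{\pi^\omega}).$$ (2) If $L=ax$ with $v_\pi(a)=\lambda<\infty$, then $$G_Q(z)=\sum_{0\le i<\lambda-2\ell}\frac{z^c}{q_{(i)}}H_{Q_{(i)}}(z^{\pi^i})G_{Q_{(i+1)}}(z^{\pi^{i+1}})\prod_{2\le j\le2\ell}G_{Q_{i+j}}(z^{\pi^{i+j}})+\sum_{\max\{0,\lambda-2\ell\}\le i<\lambda}\frac{z^{c+\pi^\lambda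 R}}{q_{(i)}}H_{Q_{(i)}}(z^{\pi^i})G_{Q_{(i+1)}}(z^{\pi^{i+1}})\prod_{2\le j\le2\ell}G_{Q_{i+j}}(z^{\pi^{i+j}})+\frac{z^{c+\pi^\lambda R}}{q_{(\lambda)}}.$$
   Context: $K$ is a $p$-adic field with valuation ring $R$, uniformizer $\pi$, residue field of order $q$, valuation $v_\pi$. A quadratic form over $R$ is $x^TMx$ with $M$ symmetric over $R$; unimodular means $\det M\in R^*$; $\oplus$ denotes a sum in disjoint variables. $R_k=R/\pi^kR$; $\mathcal A_k$ is the complex group algebra of $(R_k,+)$ with basis $\gamma^A$; $\mathcal G$ is the inverse limit of the $\mathcal A_k$ under reduction maps (a $\mathbb C$-algebra), with projections $\phi_k$; write $\phi_k(F)=\sum F_A\gamma^A$, $F(1)=\sum_AF_A$. The $p$-adic generating function of $f\in R[x_1,\dots,x_n]$ has $\phi_k$-image $q^{-nk}\sum_{A\in R_k^n}\gamma^{f(A)}$; for homogeneous $f$, its head has $\phi_k$-image $q^{-nk}\sum_{A\in R_k^n,\ A\not\equiv0\ (\mathrm{mod}\ \pi)}\gamma^{f(A)}$ ($k\ge1$). For $A$ a coset $a+\pi^jR$ or a singleton $\{a\}$, $z^A$ has $\phi_k(z^A)=N^{-1}\sum_{C\in R_k,\ C\cap A\ne\emptyset}\gamma^C$ ($N$ the number of such $C$); $z^a:=z^{\{a\}}$. For $s\in R$, $F(z^s)$ has $\phi_k(F(z^s))=F(1)\gamma^{\pi^kR}$ for $k\le v_\pi(s)$ and $\sum_{A\in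 R_{k-v_\pi(s)}}F_A\gamma^{sA}$ for $k\ge v_\pi(s)$. Empty products equal 1. *)

(* Defs.v *)
From HB Require Import structures.
From mathcomp Require Import all_boot all_order all_algebra.
From mathcomp Require Import ring_quotient mpoly.
From mathcomp Require Import boolp classical_sets.

Set Implicit Arguments.
Unset Strict Implicit.
Unset Printing Implicit Defensive.

Import Order.TTheory GRing.Theory Num.Theory.
Local Open Scope ring_scope.

(* "n <= v x", with the convention v 0 = +oo: the value of v at 0 is never
   used. *)
Definition val_ge (K : fieldType) (v : K -> int) (n : int) (x : K) : bool :=
  (x == 0) || (n <= v x).

(* p-adic fields as fields of characteristic 0, complete with respect to a
   normalized discrete valuation, with finite residue field; these are the
   finite extensions of the fields Q_p. *)
Record padicField := PadicField {
  pK :> fieldType;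
  pval : pK -> int;
  pvalM : forall x y, x != 0 -> y != 0 -> pval (x * y) = pval x + pval y;
  pvalD : forall x y, x != 0 -> y != 0 -> x + y != 0 ->
    Num.min (pval x) (pval y) <= pval (x + y);
  pval_onto : exists2 x, x != 0 & pval x = 1;
  pK_char0 : [pchar pK] =i pred0;
  pK_complete : forall u : nat -> pK,
    (forall n : int, exists N : nat, forall i j : nat,
       (N <= i)%N -> (N <= j)%N -> val_ge pval n (u i - u j)) ->
    exists l : pK, forall n : int, exists N : nat, forall i : nat,
       (N <= i)%N -> val_ge pval n (u i - l);
  pK_residue_finite : exists s : seq pK, forall x : pK, val_ge pval 0 x ->
    exists2 y, y \in s & val_ge pval 1 (x - y)
}.

Section ValuationRing.
Variable K : padicField.
Implicit Types x y : K.
Local Notation v := (@pval K).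

Lemma pval1 : v 1 = 0.
Proof.
have := @pvalM K 1 1 (oner_neq0 _) (oner_neq0 _); rewrite mulr1 => h.
by apply: (@addrI _ (v 1)); rewrite addr0 -h.
Qed.

Lemma pvalN x : v (- x) = v x.
Proof.
have [->|x0] := eqVneq x 0; first by rewrite oppr0.
have N10 : (-1 : K) != 0 by rewrite oppr_eq0 oner_neq0.
have h : v (-1) = 0.
  have := pvalM N10 N10; rewrite mulrNN mulr1 pval1 => /esym/eqP.
  by rewrite -mulr2n mulrn_eq0 /= => /eqP.
by rewrite -mulN1r pvalM // h add0r.
Qed.

Lemma pvalV x : x != 0 -> v x^-1 = - v x.
Proof.
move=> x0; apply/eqP; rewrite -addr_eq0 -pvalM ?invr_eq0 //.
by rewrite mulVf // pval1.
Qed.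

Lemma val_geN n x : val_ge v n (- x) = val_ge v n x.
Proof. by rewrite /val_ge oppr_eq0 pvalN. Qed.

Lemma val_geD n x y : val_ge v n x -> val_ge v n y -> val_ge v n (x + y).
Proof.
rewrite /val_ge; have [->|x0] /= := eqVneq x 0; first by rewrite add0r.
have [->|y0] /= := eqVneq y 0; first by rewrite addr0 (negPf x0).
have [//|s0] /= := eqVneq (x + y) 0 => hx hy.
by apply: le_trans (pvalD x0 y0 s0); rewrite le_min hx hy.
Qed.

Lemma val_geM m n x y :
  val_ge v m x -> val_ge v n y -> val_ge v (m + n) (x * y).
Proof.
rewrite /val_ge mulf_eq0; have [//|x0] /= := eqVneq x 0.
by have [//|y0] /= := eqVneq y 0 => hx hy; rewrite pvalM // lerD.
Qed.

Definition vring_pred : {pred K} := fun x => val_ge v 0 x.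

Lemma vring_pred_subring : subring_closed vring_pred.
Proof.
split=> [|x y hx hy|x y hx hy]; rewrite /vring_pred unfold_in.
- by rewrite /val_ge pval1 lexx orbT.
- by apply: val_geD => //; rewrite val_geN.
- by rewrite -(addr0 0); apply: val_geM.
Qed.

HB.instance Definition _ :=
  GRing.isSubringClosed.Build K vring_pred vring_pred_subring.

Record vring := VRing { vr_val : K; vr_valP : vr_val \in vring_pred }.

HB.instance Definition _ := [isSub for vr_val].
HB.instance Definition _ := [Choice of vring by <:].
HB.instance Definition _ := [SubChoice_isSubComNzRing of vring by <:].

Definition vr_unit : {pred vring} :=
  fun x : vring => (vr_val x != 0) && (v (vr_val x) == 0).

Definition vr_inv (x : vring) : vring :=
  if vr_unit x then insubd x (vr_val x)^-1 else x.

Lemma vr_valM (x y : vring) : vr_val (x * y) = vr_val x * vr_val y.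
Proof. exact: (rmorphM (val : vring -> K)). Qed.

Lemma vr_valB (x y : vring) : vr_val (x - y) = vr_val x - vr_val y.
Proof. exact: (rmorphB (val : vring -> K)). Qed.

Lemma vr_val_inj : injective vr_val.
Proof. exact: val_inj. Qed.

Lemma vr_val1 : vr_val 1 = 1.
Proof. exact: (rmorph1 (val : vring -> K)). Qed.

Lemma vr_mulVx : {in vr_unit, left_inverse 1 vr_inv *%R}.
Proof.
move=> x ux; apply: vr_val_inj; rewrite vr_valM vr_val1 /vr_inv.
rewrite (ux : vr_unit x); case/andP: ux => x0 /eqP vx.
have h : (vr_val x)^-1 \in vring_pred.
  by rewrite unfold_in /val_ge pvalV // vx oppr0 lexx orbT.
by rewrite [X in X * _](_ : _ = (vr_val x)^-1) ?mulVf //; exact: (insubdK x h).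
Qed.

Lemma vr_unitPl (x y : vring) : y * x = 1 -> vr_unit x.
Proof.
move/(congr1 vr_val); rewrite vr_valM vr_val1 => h.
have h0 : vr_val y * vr_val x != 0 by rewrite h oner_neq0.
move: (h0); rewrite mulf_eq0 negb_or => /andP[y0 x0].
rewrite /vr_unit x0 /=; have := pvalM y0 x0; rewrite h pval1 => hv.
have := vr_valP x; have := vr_valP y.
rewrite !unfold_in /val_ge (negPf x0) (negPf y0) /= => vy vx.
rewrite eq_le vx andbT; have -> : v (vr_val x) = - v (vr_val y).
  by apply/eqP; rewrite -addr_eq0 addrC -hv.
by rewrite oppr_le0.
Qed.

Lemma vr_invr_out : {in [predC vr_unit], vr_inv =1 id}.
Proof. by move=> x nx; rewrite /vr_inv (negbTE (nx : ~~ vr_unit x)). Qed.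

HB.instance Definition _ := GRing.ComNzRing_hasMulInverse.Build vring
  vr_mulVx vr_unitPl vr_invr_out.

End ValuationRing.

Record uniformizer (K : padicField) := Uniformizer {
  unif :> vring K;
  unif_neq0 : vr_val unif != 0;
  unif_val : pval (vr_val unif) = 1
}.

Section Quotients.
Variables (K : padicField) (pi : uniformizer K).
Local Notation R := (vring K).
Local Notation v := (@pval K).

Definition pideal (k : nat) : {pred R} :=
  fun x => `[< exists y : R, x = (pi : R) ^+ k * y >].

Lemma pidealP k x : reflect (exists y : R, x = (pi : R) ^+ k * y) (x \in pideal k).
Proof. exact: asboolP. Qed.

Lemma pideal_zmod k : zmod_closed (pideal k).
Proof.
split=> [|x y /pidealP[a ->] /pidealP[b ->]]; apply/pidealP.
  by exists 0; rewrite mulr0.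
by exists (a - b); rewrite mulrBr.
Qed.

HB.instance Definition _ k :=
  GRing.isZmodClosed.Build R (pideal k) (pideal_zmod k).

Lemma vr_valX (x : R) k : vr_val (x ^+ k) = vr_val x ^+ k.
Proof. exact: (rmorphXn (val : R -> K)). Qed.

Lemma unifX_neq0 k : vr_val ((pi : R) ^+ k) != 0.
Proof. by rewrite vr_valX expf_neq0 // unif_neq0. Qed.

Lemma unifX_val k : v (vr_val ((pi : R) ^+ k)) = k%:Z.
Proof.
elim: k => [|k IH]; first by rewrite expr0 vr_val1 pval1.
by rewrite exprS vr_valM pvalM ?unif_neq0 ?unifX_neq0 // unif_val IH -PoszD add1n.
Qed.

Lemma pideal_valE k x : (x \in pideal k) = val_ge v k%:Z (vr_val x).
Proof.
apply/pidealP/idP => [[y ->]|h].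
  rewrite vr_valM -[k%:Z]addr0; apply: val_geM; last exact: vr_valP.
  by rewrite /val_ge unifX_val lexx orbT.
have hy : vr_val x / vr_val ((pi : R) ^+ k) \in @vring_pred K.
  rewrite unfold_in -(subrr k%:Z); apply: val_geM => //.
  by rewrite /val_ge pvalV ?unifX_neq0 // unifX_val lexx orbT.
exists (VRing hy); apply: vr_val_inj; rewrite vr_valM /=.
by rewrite mulrC divfK // unifX_neq0.
Qed.

(* R / pi^k R *)
Definition Rk (k : nat) := Quotient.quot (pideal k).

HB.instance Definition _ k := GRing.Zmodule.on (Rk k).

Definition cls (k : nat) (x : R) : Rk k := (\pi_(Rk k) x)%qT.

Definition rep (k : nat) (A : Rk k) : R := repr A.

Lemma repK k (A : Rk k) : cls k (rep A) = A.
Proof. exact: reprK. Qed.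

Lemma clsP k x y : reflect (cls k x = cls k y) (x - y \in pideal k).
Proof. by rewrite Quotient.idealrBE; apply: eqP. Qed.

Lemma clsD k x y : cls k (x + y) = cls k x + cls k y.
Proof. exact: (raddfD (\pi_(Quotient.quot (pideal k)))%qT). Qed.

Lemma cls0 k : cls k 0 = 0.
Proof. exact: (raddf0 (\pi_(Quotient.quot (pideal k)))%qT). Qed.

Lemma Rk_cover k : exists s : seq R, forall x, exists2 y, y \in s & x - y \in pideal k.
Proof.
have [sK hK] := @pK_residue_finite K.
pose s1 : seq R := pmap (insub : K -> option R) sK.
have h1 x : exists2 y, y \in s1 & x - y \in pideal 1.
  have [y ys hy] := hK (vr_val x) (vr_valP x).
  have yR : y \in @vring_pred K.
    rewrite -[y](subKr (vr_val x)) rpredB ?vr_valP //.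
    rewrite unfold_in /val_ge; case/orP: hy => [->//|h].
    by rewrite (le_trans _ h) ?orbT.
  exists (VRing yR); last by rewrite pideal_valE vr_valB.
  rewrite mem_pmap; apply/mapP; exists y => //.
  by rewrite insubT; congr Some; apply: val_inj.
elim: k => [|k [s hs]].
  exists [:: 0] => x; exists 0; first by rewrite inE.
  by apply/pidealP; exists x; rewrite subr0 mul1r.
exists [seq y + (pi : R) ^+ k * d | y <- s, d <- s1] => x.
have [y ys /pidealP[z hz]] := hs x.
have [d ds /pidealP[w hw]] := h1 z.
exists (y + (pi : R) ^+ k * d); first exact: allpairs_f.
apply/pidealP; exists w.
by rewrite opprD addrA hz -mulrBr hw expr1 mulrA -exprSr.
Qed.

Lemma Rk_enum_ex k : exists s : seq (Rk k), forall A, A \in s.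
Proof.
have [s hs] := Rk_cover k; exists [seq cls k x | x <- s] => A.
have [y ys /clsP hy] := hs (rep A).
by apply/mapP; exists y; rewrite // -hy repK.
Qed.

Definition Rk_enum k : seq (Rk k) := undup (projT1 (cid (Rk_enum_ex k))).

Lemma mem_Rk_enum k A : A \in Rk_enum k.
Proof. by rewrite mem_undup; exact: (projT2 (cid (Rk_enum_ex k))). Qed.

Lemma Rk_enumP k : Finite.axiom (Rk_enum k).
Proof. by apply: Finite.uniq_enumP; [exact: undup_uniq | move=> A; rewrite mem_Rk_enum]. Qed.

Lemma Rk_pickleK k : pcancel (fun A => index A (Rk_enum k)) (onth (Rk_enum k)).
Proof.
move=> A; rewrite onthE (nth_map A) ?index_mem ?mem_Rk_enum //.
by rewrite nth_index ?mem_Rk_enum.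
Qed.

HB.instance Definition _ k := isCountable.Build (Rk k) (@Rk_pickleK k).
HB.instance Definition _ k := isFinite.Build (Rk k) (@Rk_enumP k).


End Quotients.

Section GroupAlgebra.
Variables (C : comNzRingType) (T : finZmodType).

(* The group algebra of T over C. It is a wrapper around {ffun T -> C} because
   the canonical product of the latter is the pointwise one. *)
Record galg := GAlg { gcoef :> {ffun T -> C} }.

HB.instance Definition _ := [isNew for gcoef].
Arguments gcoef : simpl never.
HB.instance Definition _ := [Choice of galg by <:].

Implicit Types (F G H : galg) (A B : T) (a b : C).

Lemma galgP F G : (forall A, F A = G A) -> F = G.
Proof. by case: F G => [F] [G] /= h; congr GAlg; apply/ffunP. Qed.

Definition galg_zero : galg := GAlg 0.
Definition galg_opp F : galg := GAlg (- gcoef F).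
Definition galg_add F G : galg := GAlg (gcoef F + gcoef G).

Lemma galg_addA : associative galg_add.
Proof. by move=> F G H; congr GAlg; rewrite addrA. Qed.
Lemma galg_addC : commutative galg_add.
Proof. by move=> F G; congr GAlg; rewrite addrC. Qed.
Lemma galg_add0 : left_id galg_zero galg_add.
Proof. by move=> [F]; congr GAlg; rewrite add0r. Qed.
Lemma galg_addN : left_inverse galg_zero galg_opp galg_add.
Proof. by move=> F; congr GAlg; rewrite addNr. Qed.

HB.instance Definition _ := GRing.isZmodule.Build galg
  galg_addA galg_addC galg_add0 galg_addN.

Definition gamma (A : T) : galg := GAlg [ffun B => (B == A)%:R].
Definition galg_scale a F : galg := GAlg [ffun A => a * F A].
Definition galg_mul F G : galg := GAlg [ffun A => \sum_B F B * G (A - B)].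

Lemma gcoef0 A : (0 : galg) A = 0.
Proof. by rewrite ffunE. Qed.
Lemma gcoefD F G A : (F + G) A = F A + G A.
Proof. by rewrite ffunE. Qed.
Lemma gcoef_sum (I : Type) (r : seq I) (P : pred I) (F_ : I -> galg) A :
  (\sum_(i <- r | P i) F_ i) A = \sum_(i <- r | P i) F_ i A.
Proof. by elim/big_rec2: _ => [|i x y _ <-]; rewrite (gcoef0, gcoefD). Qed.
Lemma gammaE A B : gamma A B = (B == A)%:R.
Proof. by rewrite ffunE. Qed.

Lemma galg_mulC : commutative galg_mul.
Proof.
move=> F G; apply: galgP => A; rewrite !ffunE.
rewrite (reindex_inj (inj_comp (addrI A) oppr_inj)) /=.
by apply: eq_bigr => B _; rewrite subKr mulrC.
Qed.

Lemma galg_mulDl : left_distributive galg_mul +%R.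
Proof.
move=> F G H; apply: galgP => A; rewrite !ffunE -big_split /=.
by apply: eq_bigr => B _; rewrite !ffunE mulrDl.
Qed.

Lemma galg_mulA : associative galg_mul.
Proof.
move=> F G H; apply: galgP => A; rewrite !ffunE.
under eq_bigr => B _ do rewrite ffunE big_distrr /=.
under [RHS]eq_bigr => B _ do rewrite ffunE big_distrl /=.
rewrite [RHS]exchange_big /=; apply: eq_bigr => B _.
rewrite [RHS](reindex_inj (addIr B)) /=; apply: eq_bigr => D _.
by rewrite mulrA addrK opprD addrA addrAC.
Qed.

Lemma galg_mul1 : left_id (gamma 0) galg_mul.
Proof.
move=> F; apply: galgP => A; rewrite ffunE (bigD1 0) // gammaE eqxx mul1r subr0.
by rewrite big1 /= ?addr0 // => B /negPf B0; rewrite gammaE B0 mul0r.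
Qed.

Lemma galg_1neq0 : gamma 0 != 0.
Proof.
apply/eqP => /(congr1 (fun F : galg => F 0))/eqP.
by rewrite gammaE gcoef0 eqxx oner_eq0.
Qed.

HB.instance Definition _ := GRing.Zmodule_isComNzRing.Build galg
  galg_mulA galg_mulC galg_mul1 galg_mulDl galg_1neq0.

Lemma galg_scaleA a b F : galg_scale a (galg_scale b F) = galg_scale (a * b) F.
Proof. by apply: galgP => A; rewrite !ffunE mulrA. Qed.
Lemma galg_scale1 : left_id 1 galg_scale.
Proof. by move=> F; apply: galgP => A; rewrite ffunE mul1r. Qed.
Lemma galg_scaleDr : right_distributive galg_scale +%R.
Proof. by move=> a F G; apply: galgP => A; rewrite !ffunE mulrDr. Qed.
Lemma galg_scaleDl F : {morph galg_scale^~ F : a b / a + b}.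
Proof. by move=> a b; apply: galgP => A; rewrite !ffunE mulrDl. Qed.

HB.instance Definition _ := GRing.Zmodule_isLmodule.Build C galg
  galg_scaleA galg_scale1 galg_scaleDr galg_scaleDl.

Lemma gcoefZ a F A : (a *: F) A = a * F A.
Proof. by rewrite ffunE. Qed.

Lemma galg_scaleAl a F G : a *: (F * G) = a *: F * G.
Proof.
apply: galgP => A; rewrite gcoefZ !ffunE mulr_sumr.
by apply: eq_bigr => B _; rewrite ?gcoefZ ?ffunE mulrA.
Qed.

HB.instance Definition _ := GRing.Lmodule_isLalgebra.Build C galg galg_scaleAl.
HB.instance Definition _ := GRing.Lalgebra_isComAlgebra.Build C galg.

Lemma galgE F : F = \sum_A F A *: gamma A.
Proof.
apply: galgP => B; rewrite gcoef_sum (bigD1 B) // gcoefZ gammaE eqxx mulr1.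
rewrite big1 /= ?addr0 // => A /negPf AB.
by rewrite gcoefZ gammaE eq_sym AB mulr0.
Qed.

Lemma gammaD A B : gamma (A + B) = gamma A * gamma B.
Proof.
apply: galgP => D; rewrite gammaE ffunE (bigD1 A) // !gammaE eqxx mul1r.
rewrite big1 => [|E /negPf EA]; last by rewrite gammaE EA mul0r.
by rewrite /= addr0 subr_eq addrC.
Qed.

End GroupAlgebra.

Arguments gcoef : simpl never.
Arguments gamma C {T} A.

Section Pushforward.
Variables (C : comNzRingType) (T U : finZmodType) (g : T -> U).

(* The linear map sending gamma A to gamma (g A). *)
Definition gpush (F : galg C T) : galg C U := \sum_A F A *: gamma C (g A).

Lemma gpushE F B : gpush F B = \sum_(A | g A == B) F A.
Proof.
rewrite /gpush gcoef_sum [RHS]big_mkcond; apply: eq_bigr => A _.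
by rewrite gcoefZ gammaE eq_sym; case: eqP => _; rewrite (mulr0, mulr1).
Qed.

Lemma gpush_linear : linear gpush.
Proof.
move=> a F G; rewrite /gpush scaler_sumr -big_split /=; apply: eq_bigr => A _.
by rewrite gcoefD gcoefZ scalerDl scalerA.
Qed.

HB.instance Definition _ :=
  GRing.isLinear.Build C (galg C T) (galg C U) _ gpush gpush_linear.

Lemma gpush_gamma A : gpush (gamma C A) = gamma C (g A).
Proof.
rewrite /gpush (bigD1 A) // gammaE eqxx scale1r big1 /= ?addr0 // => B /negPf BA.
by rewrite gammaE BA scale0r.
Qed.

Lemma gpushM : {morph g : A B / A + B} -> {morph gpush : F G / F * G}.
Proof.
move=> gD F G; rewrite {1}(galgE F) {1}(galgE G).
rewrite mulr_suml linear_sum [in RHS]/gpush mulr_suml; apply: eq_bigr => A _.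
rewrite mulr_sumr linear_sum mulr_sumr; apply: eq_bigr => B _.
rewrite -!scalerAl -!scalerAr -!gammaD !linearZ /= gpush_gamma gD.
by rewrite !scalerA mulrC.
Qed.

Lemma gpush_sum (F : galg C T) : \sum_B gpush F B = \sum_A F A.
Proof.
under eq_bigr => B _ do rewrite gpushE.
by rewrite [RHS](partition_big g xpredT).
Qed.

End Pushforward.

Section InverseLimit.
Variables (C : numFieldType) (K : padicField) (pi : uniformizer K).
Local Notation R := (vring K).
Local Notation v := (@pval K).

(* The residue field is R / pi R. *)
Definition resq : nat := #|{: Rk pi 1}|.

(* Reduction modulo pi^j, for j <= k. *)
Definition Rred (j k : nat) (A : Rk pi k) : Rk pi j := cls pi j (rep A).

Lemma pideal_le j k x : (j <= k)%N -> x \in pideal pi k -> x \in pideal pi j.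
Proof.
move=> jk /pidealP[y ->]; apply/pidealP; exists ((pi : R) ^+ (k - j) * y).
by rewrite mulrA -exprD subnKC.
Qed.

Lemma pidealMr k (x y : R) : x \in pideal pi k -> x * y \in pideal pi k.
Proof. by move=> /pidealP[z ->]; apply/pidealP; exists (z * y); rewrite mulrA. Qed.

Lemma rep_cls k x : rep (cls pi k x) - x \in pideal pi k.
Proof. by apply/clsP; rewrite repK. Qed.

Lemma Rred_cls j k x : (j <= k)%N -> Rred j (cls pi k x) = cls pi j x.
Proof. by move=> jk; apply/clsP/(pideal_le jk)/rep_cls. Qed.

Lemma Rred_id k (A : Rk pi k) : Rred k A = A.
Proof. exact: repK. Qed.

Lemma Rred_trans i j k (A : Rk pi k) :
  (i <= j)%N -> Rred i (Rred j A) = Rred i A.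
Proof. by move=> ij; rewrite {1}/Rred [Rred j A]/Rred -/(Rred i _) Rred_cls. Qed.

Lemma RredD j k : (j <= k)%N -> {morph @Rred j k : A B / A + B}.
Proof.
move=> jk A B; rewrite -{1}(repK A) -{1}(repK B) -clsD Rred_cls //.
by rewrite clsD.
Qed.

(* The inverse limit of the group algebras of the R / pi^k R; gphi F k is the
   k-th projection of F. *)
Record padicGF := PadicGF {
  gphi : forall k, galg C (Rk pi k);
  gphiP : forall k, gpush (@Rred k k.+1) (gphi k.+1) = gphi k
}.

HB.instance Definition _ := gen_eqMixin padicGF.
HB.instance Definition _ := gen_choiceMixin padicGF.

Implicit Types (F G H : padicGF) (a b : C).

Lemma padicGF_eq F G : (forall k, gphi F k = gphi G k) -> F = G.
Proof.
case: F G => [F hF] [G hG] /= h.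
have e : F = G by apply: functional_extensionality_dep.
by case: _ / e hG {h} => hG; congr PadicGF; apply: Prop_irrelevance.
Qed.

Fact gf_zeroP k : gpush (@Rred k k.+1) (0 : galg C _) = 0.
Proof. exact: linear0. Qed.
Fact gf_oppP F k : gpush (@Rred k k.+1) (- gphi F k.+1) = - gphi F k.
Proof. by rewrite linearN /= gphiP. Qed.
Fact gf_addP F G k :
  gpush (@Rred k k.+1) (gphi F k.+1 + gphi G k.+1) = gphi F k + gphi G k.
Proof. by rewrite linearD /= !gphiP. Qed.
Fact gf_oneP k : gpush (@Rred k k.+1) (1 : galg C _) = 1.
Proof. by rewrite gpush_gamma -(cls0 pi k.+1) Rred_cls // cls0. Qed.
Fact gf_mulP F G k :
  gpush (@Rred k k.+1) (gphi F k.+1 * gphi G k.+1) = gphi F k * gphi G k.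
Proof. by rewrite gpushM ?gphiP //; apply: RredD. Qed.
Fact gf_scaleP a F k :
  gpush (@Rred k k.+1) (a *: gphi F k.+1) = a *: gphi F k.
Proof. by rewrite linearZ /= gphiP. Qed.

Definition gf_zero := PadicGF gf_zeroP.
Definition gf_opp F := PadicGF (gf_oppP F).
Definition gf_add F G := PadicGF (gf_addP F G).
Definition gf_one := PadicGF gf_oneP.
Definition gf_mul F G := PadicGF (gf_mulP F G).
Definition gf_scale a F := PadicGF (gf_scaleP a F).

Fact gf_addA : associative gf_add.
Proof. by move=> F G H; apply: padicGF_eq => k /=; rewrite addrA. Qed.
Fact gf_addC : commutative gf_add.
Proof. by move=> F G; apply: padicGF_eq => k /=; rewrite addrC. Qed.
Fact gf_add0 : left_id gf_zero gf_add.
Proof. by move=> F; apply: padicGF_eq => k /=; rewrite add0r. Qed.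
Fact gf_addN : left_inverse gf_zero gf_opp gf_add.
Proof. by move=> F; apply: padicGF_eq => k /=; rewrite addNr. Qed.

HB.instance Definition _ := GRing.isZmodule.Build padicGF
  gf_addA gf_addC gf_add0 gf_addN.

Fact gf_mulA : associative gf_mul.
Proof. by move=> F G H; apply: padicGF_eq => k /=; rewrite mulrA. Qed.
Fact gf_mulC : commutative gf_mul.
Proof. by move=> F G; apply: padicGF_eq => k /=; rewrite mulrC. Qed.
Fact gf_mul1 : left_id gf_one gf_mul.
Proof. by move=> F; apply: padicGF_eq => k /=; rewrite mul1r. Qed.
Fact gf_mulDl : left_distributive gf_mul +%R.
Proof. by move=> F G H; apply: padicGF_eq => k /=; rewrite mulrDl. Qed.
Fact gf_1neq0 : gf_one != 0.
Proof. by apply/eqP => /(congr1 (gphi^~ 0%N))/eqP; rewrite oner_eq0. Qed.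

HB.instance Definition _ := GRing.Zmodule_isComNzRing.Build padicGF
  gf_mulA gf_mulC gf_mul1 gf_mulDl gf_1neq0.

Fact gf_scaleA a b F : gf_scale a (gf_scale b F) = gf_scale (a * b) F.
Proof. by apply: padicGF_eq => k /=; rewrite scalerA. Qed.
Fact gf_scale1 : left_id 1 gf_scale.
Proof. by move=> F; apply: padicGF_eq => k /=; rewrite scale1r. Qed.
Fact gf_scaleDr : right_distributive gf_scale +%R.
Proof. by move=> a F G; apply: padicGF_eq => k /=; rewrite scalerDr. Qed.
Fact gf_scaleDl F : {morph gf_scale^~ F : a b / a + b}.
Proof. by move=> a b; apply: padicGF_eq => k /=; rewrite scalerDl. Qed.

HB.instance Definition _ := GRing.Zmodule_isLmodule.Build C padicGF
  gf_scaleA gf_scale1 gf_scaleDr gf_scaleDl.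

Fact gf_scaleAl a F G : a *: (F * G) = a *: F * G.
Proof. by apply: padicGF_eq => k /=; rewrite scalerAl. Qed.

HB.instance Definition _ := GRing.Lmodule_isLalgebra.Build C padicGF gf_scaleAl.
HB.instance Definition _ := GRing.Lalgebra_isComAlgebra.Build C padicGF.

(* F(1), which can be read off any projection. *)
Definition aug (F : padicGF) : C := \sum_A gphi F 0 A.

Lemma augE F k : aug F = \sum_A gphi F k A.
Proof. by elim: k => [//|k ->]; rewrite -(gphiP F k) gpush_sum. Qed.

Lemma Rred_fibre k (B : Rk pi k) :
  #|[pred A : Rk pi k.+1 | Rred k A == B]| = resq.
Proof.
pose h (D : Rk pi 1) := cls pi k.+1 (rep B + (pi : R) ^+ k * rep D).
have hinj : injective h.
  move=> D E /clsP/pidealP[y].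
  rewrite opprD addrACA subrr add0r -mulrBr exprSr -mulrA => e.
  rewrite -(repK D) -(repK E); apply/clsP/pidealP; exists y; rewrite expr1.
  apply: vr_val_inj; apply: (mulfI (unifX_neq0 pi k)).
  by rewrite -!vr_valM e.
rewrite /resq -(card_codom hinj); apply: eq_card => A; rewrite !inE.
apply/eqP/codomP => [e|[D ->]]; last first.
  rewrite Rred_cls // -[RHS]repK; apply/clsP/pidealP.
  by exists (rep D); rewrite addrAC subrr add0r.
have /clsP/pidealP[y hy] : cls pi k (rep A) = cls pi k (rep B) by rewrite repK.
exists (cls pi 1 y); rewrite -(repK A); apply/clsP.
rewrite opprD addrA hy -mulrBr.
have /pidealP[z] := rep_cls 1 y; rewrite -[y - _]opprB => ->.
by apply/pidealP; exists (- z); rewrite mulrN mulrA -exprD addn1 -mulrN.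
Qed.

Lemma resq_gt0 : (0 < resq)%N.
Proof. by apply/card_gt0P; exists 0. Qed.

Lemma Rred_fibreX n k (B : {ffun 'I_n -> Rk pi k}) :
  #|[pred A : {ffun 'I_n -> Rk pi k.+1} | [ffun i => Rred k (A i)] == B]|
  = (resq ^ n)%N.
Proof.
rewrite -[RHS](_ : #|family (fun i : 'I_n =>
  [pred A : Rk pi k.+1 | Rred k A == B i])| = _).
  apply: eq_card => A; rewrite inE; apply/eqP/familyP => [<- i|h].
    by rewrite inE ffunE.
  by apply/ffunP => i; rewrite ffunE; apply/eqP/h.
rewrite card_family /image_mem (eq_map (fun i => Rred_fibre (B i))).
rewrite -[in RHS](size_enum_ord n); elim: (enum 'I_n) => //= i s ->.
by rewrite expnS.
Qed.

End InverseLimit.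

Section Elements.
Variables (C : numFieldType) (K : padicField) (pi : uniformizer K).
Local Notation R := (vring K).
Local Notation v := (@pval K).
Local Notation q := (resq pi).
Local Notation GF := (padicGF C pi).

(* f(A), for A in (R / pi^k R)^n. *)
Definition evalk n (f : {mpoly R[n]}) k (A : {ffun 'I_n -> Rk pi k}) : Rk pi k :=
  cls pi k f.@[fun i => rep (A i)].

Lemma meval_congr n (f : {mpoly R[n]}) k (x y : 'I_n -> R) :
  (forall i, x i - y i \in pideal pi k) -> f.@[x] - f.@[y] \in pideal pi k.
Proof.
move=> h; rewrite !mevalE -sumrB; apply: rpred_sum => m _.
rewrite -mulrBr mulrC; apply: pidealMr.
elim/big_rec2: _ => [|i b a _ IH]; first by rewrite subrr rpred0.
have -> : x i ^+ m i * a - y i ^+ m i * b =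
    x i ^+ m i * (a - b) + (x i ^+ m i - y i ^+ m i) * b.
  by rewrite mulrBr mulrBl addrA subrK.
rewrite rpredD //; first by rewrite mulrC pidealMr.
by rewrite pidealMr // subrXX pidealMr.
Qed.

Lemma evalk_red n (f : {mpoly R[n]}) k (A : {ffun 'I_n -> Rk pi k.+1}) :
  Rred k (evalk f A) = evalk f [ffun i => Rred k (A i)].
Proof.
rewrite Rred_cls //; apply/clsP/meval_congr => i; rewrite ffunE.
by rewrite -opprB rpredN rep_cls.
Qed.

Lemma evalk_sum_compat n (f : {mpoly R[n]}) k
    (P : pred {ffun 'I_n -> Rk pi k.+1}) (P' : pred {ffun 'I_n -> Rk pi k}) :
  (forall A, P A = P' [ffun i => Rred k (A i)]) ->
  gpush (@Rred _ pi k k.+1)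
    (q%:R ^- (n * k.+1) *: \sum_(A | P A) gamma C (evalk f A))
  = q%:R ^- (n * k) *: \sum_(A | P' A) gamma C (evalk f A).
Proof.
move=> hP; rewrite linearZ linear_sum /=.
pose rv (A : {ffun 'I_n -> Rk pi k.+1}) := [ffun i => Rred k (A i)].
rewrite (partition_big rv P') => [|A]; last by rewrite hP.
have q0 m : (q%:R ^+ m : C) != 0.
  by rewrite expf_neq0 // pnatr_eq0 -lt0n resq_gt0.
rewrite !scaler_sumr; apply: eq_bigr => B PB.
rewrite (eq_bigr (fun=> gamma C (evalk f B))) => [|A /andP[_ /eqP <-]]; last first.
  by rewrite gpush_gamma evalk_red.
rewrite sumr_const (_ : #|_| = (q ^ n)%N) => [|]; last first.
  rewrite -(Rred_fibreX B); apply: eq_card => A; rewrite !inE.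
  by rewrite unfold_in hP -/(rv A); case: eqP => [->|_]; rewrite ?PB ?andbF.
rewrite -scaler_nat scalerA natrX; congr (_ *: _).
by rewrite mulnS exprD invfM mulrAC mulVf ?mul1r.
Qed.

Definition genfun_fam n (f : {mpoly R[n]}) k : galg C (Rk pi k) :=
  q%:R ^- (n * k) *: \sum_(A : {ffun 'I_n -> Rk pi k}) gamma C (evalk f A).

Fact genfunP n (f : {mpoly R[n]}) k :
  gpush (@Rred _ pi k k.+1) (genfun_fam f k.+1) = genfun_fam f k.
Proof. exact: evalk_sum_compat. Qed.

Definition genfun n (f : {mpoly R[n]}) : GF := PadicGF (genfunP f).

Definition primitive n k (A : {ffun 'I_n -> Rk pi k}) : bool :=
  [exists i, Rred 1 (A i) != 0].

Definition head_sum n (f : {mpoly R[n]}) k : galg C (Rk pi k) :=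
  q%:R ^- (n * k) *:
    \sum_(A : {ffun 'I_n -> Rk pi k} | primitive A) gamma C (evalk f A).

(* The projection of index 0 is determined by the one of index 1. *)
Definition head_fam n (f : {mpoly R[n]}) k : galg C (Rk pi k) :=
  if k is k'.+1 then head_sum f k'.+1
  else gpush (@Rred _ pi 0 1) (head_sum f 1).

Fact headP n (f : {mpoly R[n]}) k :
  gpush (@Rred _ pi k k.+1) (head_fam f k.+1) = head_fam f k.
Proof.
case: k => [//|k]; apply: evalk_sum_compat => A.
by apply: eq_existsb => i; rewrite ffunE Rred_trans.
Qed.

Definition genhead n (f : {mpoly R[n]}) : GF := PadicGF (headP f).

Local Open Scope classical_set_scope.

(* A class modulo pi^k as a subset of R. *)
Definition coset k (B : Rk pi k) : set R := [set x | cls pi k x = B].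

Definition meets (A : set R) k : pred (Rk pi k) :=
  fun B => `[< coset B `&` A !=set0 >].

Arguments meets A k B : clear implicits.

Definition zfam (A : set R) k : galg C (Rk pi k) :=
  #|meets A k|%:R^-1 *: \sum_(B | meets A k B) gamma C B.

Lemma meetsP (A : set R) k B :
  reflect (exists2 a, A a & cls pi k a = B) (meets A k B).
Proof. by apply: (iffP (asboolP _)) => [[a [h Aa]]|[a Aa h]]; exists a. Qed.

Lemma zfam_compat (A : set R) k m : (0 < m)%N ->
  (forall B, meets A k B ->
     #|[pred D | meets A k.+1 D && (Rred k D == B)]| = m) ->
  gpush (@Rred _ pi k k.+1) (zfam A k.+1) = zfam A k.
Proof.
move=> m0 hm; rewrite /zfam linearZ linear_sum /=.
have hM D : meets A k.+1 D -> meets A k (Rred k D).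
  by move=> /meetsP[a Aa <-]; apply/meetsP; exists a; rewrite // Rred_cls.
have hN : #|meets A k.+1| = (#|meets A k| * m)%N.
  rewrite -sum1_card (partition_big (@Rred _ pi k k.+1) (meets A k)) //=.
  rewrite -sum_nat_const; apply: eq_bigr => B hB.
  by rewrite sum1_card -(hm B hB); apply: eq_card.
rewrite (partition_big (@Rred _ pi k k.+1) (meets A k)) //= hN.
rewrite !scaler_sumr; apply: eq_bigr => B hB.
rewrite (eq_bigr (fun=> gamma C B)) => [|D /andP[_ /eqP <-]]; last first.
  by rewrite gpush_gamma.
rewrite sumr_const (_ : #|_| = m); last by rewrite -(hm B hB); apply: eq_card.
rewrite -scaler_nat scalerA natrM invfM mulfVK // pnatr_eq0 -lt0n //.
Qed.

Fact zptP (a : R) k :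
  gpush (@Rred _ pi k k.+1) (zfam [set a] k.+1) = zfam [set a] k.
Proof.
apply: (@zfam_compat _ _ 1) => // B /meetsP[_ -> <-].
rewrite -(card1 (cls pi k.+1 a)); apply: eq_card => D; rewrite !inE.
apply/andP/eqP => [[/meetsP[_ -> <-]]//|->]; rewrite Rred_cls // eqxx.
by split=> //; apply/meetsP; exists a.
Qed.

Definition pcoset (a : R) (j : nat) : set R :=
  [set x | exists y : R, x = a + (pi : R) ^+ j * y].

Fact zcosetP (a : R) (j k : nat) :
  gpush (@Rred _ pi k k.+1) (zfam (pcoset a j) k.+1) = zfam (pcoset a j) k.
Proof.
have [jk|kj] := leqP j k; last first.
  apply: (@zfam_compat _ _ 1) => // B /meetsP[_ [x ->] <-].
  have cst i y : (i <= j)%N -> cls pi i (a + (pi : R) ^+ j * y) = cls pi i a.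
    move=> ij; apply/clsP/(pideal_le ij)/pidealP.
    by exists y; rewrite addrAC subrr add0r.
  rewrite -(card1 (cls pi k.+1 a)); apply: eq_card => D; rewrite !inE.
  apply/andP/eqP => [[/meetsP[_ [y ->] <-] _]|->]; first exact: cst.
  rewrite Rred_cls // cst ?(ltnW kj) // eqxx.
  by split=> //; apply/meetsP; exists a => //; exists 0; rewrite mulr0 addr0.
apply: (@zfam_compat _ _ q) => [|B /meetsP[_ [x ->] <-]]; first exact: resq_gt0.
rewrite -(Rred_fibre (cls pi k (a + (pi : R) ^+ j * x))).
apply: eq_card => D; rewrite !inE; case: eqP => [|_]; rewrite ?andbF // andbT.
rewrite {1}/Rred => /clsP/(pideal_le jk)/pidealP[y hy]; apply/meetsP.
exists (rep D); last exact: repK.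
by exists (x + y); rewrite mulrDr addrA -hy addrC subrK.
Qed.

Definition zpt (a : R) : GF := PadicGF (zptP a).
Definition zcoset (a : R) (j : nat) : GF := PadicGF (zcosetP a j).

Local Close Scope classical_set_scope.

Definition subst_fam (F : GF) (s : R) k : galg C (Rk pi k) :=
  if val_ge v k%:Z (vr_val s) then aug F *: gamma C (cls pi k 0)
  else \sum_(A : Rk pi (k - `|v (vr_val s)|)%N)
         gphi F _ A *: gamma C (cls pi k (s * rep A)).

Fact substP (F : GF) (s : R) k :
  gpush (@Rred _ pi k k.+1) (subst_fam F s k.+1) = subst_fam F s k.
Proof.
rewrite /subst_fam; set w := `|v (vr_val s)|%N.
case: ifPn => [h1|]; last rewrite /val_ge negb_or -ltNge => /andP[s0 h1].
  case: ifPn => [_|]; first by rewrite linearZ /= gpush_gamma Rred_cls.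
  case/negP; move: h1; rewrite /val_ge => /orP[->//|h1].
  by rewrite (le_trans _ h1) ?orbT // lez_nat.
have vs : v (vr_val s) = w.
  have := vr_valP s; rewrite unfold_in /val_ge (negPf s0) /= /w.
  by move/gez0_abs ->.
have ws : s \in pideal pi w by rewrite pideal_valE /val_ge vs lexx orbT.
move: h1; rewrite vs ltz_nat ltnS => wk.
have -> : (k.+1 - w = (k - w).+1)%N by rewrite subSn.
have hM (x y : R) : x - y \in pideal pi (k - w) -> cls pi k (s * x) = cls pi k (s * y).
  move=> /pidealP[z hz]; apply/clsP; rewrite -mulrBr hz.
  case/pidealP: ws => t ->; apply/pidealP; exists (t * z).
  by rewrite mulrACA -exprD subnKC.
rewrite linear_sum /=.
under eq_bigr => A _ do rewrite linearZ /= gpush_gamma Rred_cls //.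
transitivity (\sum_(A : Rk pi (k - w)) gphi F (k - w)%N A *: gamma C (cls pi k (s * rep A))).
  under [RHS]eq_bigr => B _ do rewrite -gphiP gpushE scaler_suml.
  rewrite (partition_big (@Rred _ pi (k - w) (k - w).+1) xpredT) //=.
  apply: eq_bigr => B _; apply: eq_bigr => A /eqP <-.
  by congr (_ *: gamma C _); apply: hM; rewrite -opprB rpredN rep_cls.
case: ifPn => [|//]; rewrite (negPf s0) orFb lez_nat => kw.
rewrite (augE F (k - w)) scaler_suml; apply: eq_bigr => A _.
congr (_ *: gamma C _); apply/clsP; rewrite subr0.
by apply: pidealMr; apply: pideal_le ws.
Qed.

(* F(z^s) *)
Definition gsubst (F : GF) (s : R) : GF := PadicGF (substP F s).

End Elements.

Section DisjointVariables.
Variable R : comNzRingType.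

(* A polynomial together with its number of variables. *)
Record dpoly := DPoly { dvars : nat; dpol : {mpoly R[dvars]} }.

(* The sum in disjoint variables: those of P come first, then those of S. *)
Definition dsum (P S : dpoly) : dpoly :=
  @DPoly (dvars P + dvars S)
    ((dpol P \mPo [tuple 'X_(lshift (dvars S) i) | i < dvars P])
     + (dpol S \mPo [tuple 'X_(rshift (dvars P) j) | j < dvars S])).

Definition dzero : dpoly := @DPoly 0 0.
Definition dscale (a : R) (P : dpoly) : dpoly := DPoly (a *: dpol P).
Definition daddc (P : dpoly) (c : R) : dpoly := DPoly (dpol P + c%:MP).

End DisjointVariables.

Arguments dsum {R} P S.
Arguments dzero {R}.

Definition qform (R : comNzRingType) n (M : 'M[R]_n) : {mpoly R[n]} :=
  \sum_i \sum_j M i j *: ('X_i * 'X_j).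

Definition unimodular_qform (R : comUnitRingType) n (f : {mpoly R[n]}) : Prop :=
  exists M : 'M[R]_n, [/\ M^T = M, \det M \is a GRing.unit & f = qform M].

Definition involves (R : comNzRingType) n (f : {mpoly R[n]}) (i : 'I_n) : bool :=
  has (fun m : 'X_{1..n} => m i != 0%N) (msupp f).

(* v x = n, with n finite *)
Definition vr_val_eq (K : padicField) (x : vring K) (n : nat) : Prop :=
  vr_val x != 0 /\ pval (vr_val x) = n%:Z.

Section Parity.
Variables (R : comNzRingType) (r : nat -> nat).

(* The direct sum of the Q_i, respectively the sum of the r_i, over the
   i <= j of the same parity as j. *)
Definition Qpar (Q : forall i, {mpoly R[r i]}) (j : nat) : dpoly R :=
  \big[dsum/dzero]_(0 <= i < j.+1 | odd i == odd j) DPoly (Q i).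
Definition rpar (j : nat) : nat :=
  (\sum_(0 <= i < j.+1 | odd i == odd j) r i)%N.
Definition qpar (q j : nat) : nat := (q ^ \sum_(0 <= i < j) rpar i)%N.

End Parity.

(* Main.v *)
(** Splitting off the vectors divisible by [pi] gives
    [G_P(z) = H_P(z) + q^-n G_P(z^(pi^2))] for a quadratic form [P] in [n]
    variables. Let [P_i] be the sum of the [Q_j] with [j <= i] of the parity of
    [i], and [F_i] the product of [G_(P_i)(z^(pi^i))], [G_(P_(i+1))(z^(pi^(i+1)))]
    and the [G_(Q_j)(z^(pi^j))] with [j >= i+2], so that [F_0] is the generating
    function of the diagonal part. Since [P_(i+2)] is the sum of [P_i] and
    [Q_(i+2)], the splitting of [G_(P_i)] writes [F_i] as a head term plus
    [q^-(r_(i)) F_(i+1)]. If [P] is unimodular, the projections of [H_P] are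
    invariant under translation by [pi^(2 ell + 1) R], so multiplying [H_P] by
    [F(z^(pi^j))] with [j > 2 ell] amounts to multiplying it by [F(1)]; this
    truncates the head terms. Likewise [z^(c + pi^lambda R)] is invariant under
    [pi^lambda R], which stops the recursion at [i = lambda] when a linear form
    is present. *)

Require Import Defs.
From mathcomp Require Import all_boot all_order all_algebra.
From mathcomp Require Import mpoly complex.
From mathcomp Require Import reals.
From mathcomp Require Import ring.
Import Order.TTheory GRing.Theory Num.Theory.
Local Open Scope ring_scope.

Set Implicit Arguments.
Unset Strict Implicit.
Unset Printing Implicit Defensive.

(** * Functoriality of pushforwards between group algebras *)

Section PushforwardTheory.
Variables (C : comNzRingType) (T U V : finZmodType).

Lemma eq_gpush (g g' : T -> U) (F : galg C T) :
  g =1 g' -> gpush g F = gpush g' F.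
Proof. by move=> e; apply: eq_bigr => A _; rewrite e. Qed.

Lemma gpush_id (F : galg C T) : gpush id F = F.
Proof. by rewrite /gpush -galgE. Qed.

Lemma gpush_comp (g : T -> U) (h : U -> V) (F : galg C T) :
  gpush h (gpush g F) = gpush (h \o g) F.
Proof.
rewrite {1}[gpush g F]/gpush linear_sum; apply: eq_bigr => A _.
by rewrite linearZ /= gpush_gamma.
Qed.

End PushforwardTheory.

(** * The substitution of z^s for z as an algebra endomorphism *)

Section Substitution.
Variables (C : numFieldType) (K : padicField) (pi : uniformizer K).
Local Notation R := (vring K).
Local Notation GF := (padicGF C pi).

Definition mulk (s : R) k (A : Rk pi k) : Rk pi k := cls pi k (s * rep A).

Lemma cls_mull k (s x y : R) :
  cls pi k x = cls pi k y -> cls pi k (s * x) = cls pi k (s * y).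
Proof.
by move/clsP => h; apply/clsP; rewrite -mulrBr mulrC; apply: pidealMr.
Qed.

Lemma mulk_cls (s : R) k x : mulk s (cls pi k x) = cls pi k (s * x).
Proof. by apply: cls_mull; rewrite repK. Qed.

Lemma mulkD (s : R) k : {morph @mulk s k : A B / A + B}.
Proof.
move=> A B; rewrite -{1}(repK A) -{1}(repK B) -clsD mulk_cls mulrDr.
by rewrite clsD.
Qed.

Lemma gphi_Rred (F : GF) j k : (j <= k)%N ->
  gpush (@Rred _ pi j k) (gphi F k) = gphi F j.
Proof.
move=> /subnKC <-; elim: (k - j)%N => [|d IH].
  by rewrite addn0 (eq_gpush _ (@Rred_id _ pi j)) gpush_id.
rewrite addnS -{}IH -(gphiP F (j + d)%N) gpush_comp; apply: eq_gpush => A /=.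
by rewrite Rred_trans // leq_addr.
Qed.

(** Multiplication by [s] on R/pi^k factors through R/pi^(k - v(s)), and vanishes when pi^k divides
    [s]. One formula at level [k] thus covers both cases of [subst_fam], and the algebraic rules for
    [gsubst] reduce to those for a pushforward along an additive map. *)
Lemma gphi_gsubst (F : GF) (s : R) k :
  gphi (gsubst F s) k = gpush (@mulk s k) (gphi F k).
Proof.
rewrite /= /subst_fam; case: ifPn => [h|].
  rewrite (augE F k) scaler_suml; apply: eq_bigr => A _.
  congr (_ *: gamma C _); apply/esym/clsP; rewrite subr0 pidealMr //.
  by rewrite pideal_valE.
rewrite /val_ge negb_or => /andP[s0]; set w := absz _.
have vs : pval (vr_val s) = w.
  have := vr_valP s; rewrite unfold_in /val_ge (negPf s0) /= /w.
  by move/gez0_abs ->.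
have ws : s \in pideal pi w by rewrite pideal_valE /val_ge vs lexx orbT.
rewrite vs lez_nat -ltnNge => /ltnW wk.
(* The projection at level [k - w] is rewritten as a reduction from level [k], so that both sides
   become pushforwards of [gphi F k]. *)
rewrite -(gphi_Rred F (leq_subr w k)).
rewrite -[LHS]/(gpush (fun A => cls pi k (s * rep A)) _) gpush_comp.
apply: eq_gpush => A /=; apply/clsP; rewrite -mulrBr.
have /pidealP[z ->] : rep (Rred (k - w) A) - rep A \in pideal pi (k - w).
  exact: rep_cls.
by case/pidealP: ws => t ->; apply/pidealP; exists (t * z);
  rewrite mulrACA -exprD subnKC.
Qed.

Lemma gphi1 k : gphi (1 : GF) k = 1. Proof. by []. Qed.
Lemma gphiM (F G : GF) k : gphi (F * G) k = gphi F k * gphi G k.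
Proof. by []. Qed.
Lemma gphiD (F G : GF) k : gphi (F + G) k = gphi F k + gphi G k.
Proof. by []. Qed.
Lemma gphiZ a (F : GF) k : gphi (a *: F) k = a *: gphi F k.
Proof. by []. Qed.

Lemma gsubst1 (s : R) : gsubst (1 : GF) s = 1.
Proof.
apply: padicGF_eq => k; rewrite gphi_gsubst gphi1 gpush_gamma.
by rewrite -{1}(cls0 pi k) mulk_cls mulr0 cls0.
Qed.

Lemma gsubstM (F G : GF) (s : R) :
  gsubst (F * G) s = gsubst F s * gsubst G s.
Proof.
apply: padicGF_eq => k; rewrite gphiM !gphi_gsubst gphiM gpushM //.
exact: mulkD.
Qed.

Lemma gsubstD (F G : GF) (s : R) :
  gsubst (F + G) s = gsubst F s + gsubst G s.
Proof.
by apply: padicGF_eq => k; rewrite gphiD !gphi_gsubst gphiD linearD.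
Qed.

Lemma gsubstZ a (F : GF) (s : R) : gsubst (a *: F) s = a *: gsubst F s.
Proof.
by apply: padicGF_eq => k; rewrite gphiZ !gphi_gsubst gphiZ linearZ.
Qed.

Lemma gsubst_comp (F : GF) (s t : R) :
  gsubst (gsubst F s) t = gsubst F (t * s).
Proof.
apply: padicGF_eq => k; rewrite !gphi_gsubst gpush_comp; apply: eq_gpush => A.
by rewrite /= mulk_cls mulrA.
Qed.

(** Heads have an explicit formula only at positive levels; this makes those levels sufficient. *)
Lemma padicGF_eqS (F G : GF) :
  (forall k, gphi F k.+1 = gphi G k.+1) -> F = G.
Proof.
by move=> e; apply: padicGF_eq => k; rewrite -!(gphi_Rred _ (leqnSn k)) e.
Qed.

End Substitution.

(** * Generating functions under scaling, translation and disjoint sums *)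

Section GenfunTheory.
Variables (C : numFieldType) (K : padicField) (pi : uniformizer K).
Local Notation R := (vring K).
Local Notation GF := (padicGF C pi).
Local Notation q := (resq pi).

Lemma gphi_genfun n (f : {mpoly R[n]}) k : gphi (genfun C pi f) k =
  q%:R ^- (n * k) *: \sum_(A : {ffun 'I_n -> Rk pi k}) gamma C (evalk f A).
Proof. by []. Qed.

Lemma gphi_genhead n (f : {mpoly R[n]}) k : gphi (genhead C pi f) k.+1 =
  q%:R ^- (n * k.+1) *:
    \sum_(A : {ffun 'I_n -> Rk pi k.+1} | primitive A) gamma C (evalk f A).
Proof. by []. Qed.

Lemma resq_neq0 : q%:R != 0 :> C.
Proof. by rewrite pnatr_eq0 -lt0n resq_gt0. Qed.

Lemma card_Rk k : #|{: Rk pi k}| = (q ^ k)%N.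
Proof.
elim: k => [|k IH].
  rewrite expn0 -(card1 (0 : Rk pi 0)); apply: eq_card => A.
  rewrite !inE -(repK A) -(cls0 pi 0); apply/esym/eqP/clsP/pidealP.
  by exists (rep A - 0); rewrite expr0 mul1r.
rewrite -sum1_card (partition_big (@Rred _ pi k k.+1) xpredT) //= expnSr -IH.
rewrite -sum_nat_const; apply: eq_bigr => B _.
by rewrite sum1_card; apply: Rred_fibre.
Qed.

Lemma card_RkX n k : #|{ffun 'I_n -> Rk pi k}| = (q ^ (n * k))%N.
Proof. by rewrite card_ffun card_Rk card_ord -expnM mulnC. Qed.

Lemma gsubst_genfun n (f : {mpoly R[n]}) s :
  gsubst (genfun C pi f) s = genfun C pi (s *: f).
Proof.
apply: padicGF_eq => k; rewrite gphi_gsubst !gphi_genfun linearZ linear_sum /=.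
congr (_ *: _); apply: eq_bigr => A _; rewrite gpush_gamma /evalk mulk_cls.
by rewrite mevalZ.
Qed.

Lemma genfun0 n : genfun C pi (0 : {mpoly R[n]}) = 1.
Proof.
apply: padicGF_eq => k; rewrite gphi_genfun gphi1.
rewrite (eq_bigr (fun=> 1)) => [|A _]; last by rewrite /evalk meval0 cls0.
rewrite sumr_const card_RkX -scaler_nat scalerA natrX mulVf ?scale1r //.
by rewrite expf_neq0 // resq_neq0.
Qed.

(** The generating function is the law of [f] at a uniform argument, so its total mass is that of a
    probability. *)
Lemma aug_genfun n (f : {mpoly R[n]}) : aug (genfun C pi f) = 1.
Proof.
rewrite /aug; under eq_bigr => A _ do rewrite gphi_genfun gcoefZ gcoef_sum.
rewrite -mulr_sumr exchange_big /= muln0 expr0 invr1 mul1r.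
rewrite (eq_bigr (fun=> 1)) => [|A _].
  by rewrite sumr_const card_RkX muln0.
rewrite (bigD1 (evalk f A)) //= gammaE eqxx big1 ?addr0 // => B /negPf h.
by rewrite gammaE h.
Qed.

Lemma meval_congr_cls n (f : {mpoly R[n]}) k (x y : 'I_n -> R) :
  (forall i, cls pi k (x i) = cls pi k (y i)) ->
  cls pi k f.@[x] = cls pi k f.@[y].
Proof. by move=> h; apply/clsP/meval_congr => i; apply/clsP. Qed.

Lemma gphi_zpt c k : gphi (zpt C pi c) k = gamma C (cls pi k c).
Proof.
have e : meets (pi := pi) (classical_sets.set1 c) (k := k) =1 pred1 (cls pi k c).
  by move=> B; apply/Defs.meetsP/eqP => [[_ -> <-]//|->]; exists c.
rewrite /= /zfam (eq_card (B := pred1 (cls pi k c))) // card1 invr1 scale1r.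
by rewrite (eq_bigl _ _ e) big_pred1_eq.
Qed.

Lemma genfun_daddc (P : dpoly R) (c : R) :
  genfun C pi (dpol (daddc P c)) = zpt C pi c * genfun C pi (dpol P).
Proof.
apply: padicGF_eq => k; rewrite gphiM gphi_zpt !gphi_genfun -scalerAr mulr_sumr.
congr (_ *: _); apply: eq_bigr => A _.
by rewrite -gammaD -clsD /evalk mevalD mevalC addrC.
Qed.

Lemma genfun_dsum (P S : dpoly R) :
  genfun C pi (dpol (dsum P S)) = genfun C pi (dpol P) * genfun C pi (dpol S).
Proof.
case: P S => [n f] [m g]; apply: padicGF_eq => k.
rewrite gphiM !gphi_genfun /= -scalerAl -scalerAr scalerA -invfM -exprD.
rewrite -mulnDl; congr (_ *: _); rewrite big_distrlr pair_big /=.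
(* Concatenation of the two blocks of variables, with inverse [h']. *)
pose h (u : {ffun 'I_n -> Rk pi k} * {ffun 'I_m -> Rk pi k})
    : {ffun 'I_(n + m) -> Rk pi k} :=
  [ffun i => match split i with inl a => u.1 a | inr b => u.2 b end].
pose h' (A : {ffun 'I_(n + m) -> Rk pi k}) :=
  ([ffun i => A (lshift m i)], [ffun i => A (rshift n i)]).
rewrite (reindex h); last first.
  exists h' => [[B D] _|A _].
    congr pair; apply/ffunP => i; rewrite !ffunE.
      by rewrite (unsplitK (inl i)).
    by rewrite (unsplitK (inr i)).
  apply/ffunP => i; rewrite !ffunE; case: splitP => j e; rewrite ffunE.
    by congr (A _); apply: val_inj.
  by congr (A _); apply: val_inj.
apply: eq_bigr => -[B D] _; rewrite -gammaD -clsD /evalk mevalD.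
rewrite !comp_mpoly_meval; set x := (X in f.@[X] + _); set y := (X in _ + g.@[X]).
have -> : f.@[x] = f.@[fun i => rep (B i)].
  by apply: meval_eq => i; rewrite /x tnth_mktuple mevalXU ffunE (unsplitK (inl i)).
have -> // : g.@[y] = g.@[fun i => rep (D i)].
by apply: meval_eq => i; rewrite /y tnth_mktuple mevalXU ffunE (unsplitK (inr i)).
Qed.

End GenfunTheory.

(** * Invariance under translation by pi^j R *)

Section Absorption.
Variables (C : numFieldType) (K : padicField) (pi : uniformizer K).
Local Notation R := (vring K).
Local Notation GF := (padicGF C pi).
Local Notation q := (resq pi).
Local Notation p := (unif pi).

(** Multiplication by a [gamma] translates coefficients, so this says that every projection of [F]
    is constant on the cosets of the image of pi^j R. *)
Definition absorbs (F : GF) (j : nat) : Prop :=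
  forall k (t : R), gphi F k * gamma C (cls pi k (p ^+ j * t)) = gphi F k.

Lemma absorbsMr (F G : GF) j : absorbs F j -> absorbs (F * G) j.
Proof. by move=> h k t; rewrite gphiM mulrAC h. Qed.

Lemma absorbs_gsubst (F : GF) i j :
  absorbs F j -> absorbs (gsubst F (p ^+ i)) (i + j).
Proof.
move=> h k t; rewrite gphi_gsubst exprD -mulrA -mulk_cls -gpush_gamma.
by rewrite -gpushM ?h //; apply: mulkD.
Qed.

Lemma absorbsP (F : GF) i j : absorbs F j -> (j <= i)%N ->
  forall k (t : R), gphi F k * gamma C (cls pi k (p ^+ i * t)) = gphi F k.
Proof. by move=> h /subnKC <- k t; rewrite exprD -mulrA h. Qed.

(** Only classes of multiples of pi^i occur in the substituted factor. Each acts trivially on [F],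
    so only the sum of its coefficients survives. *)
Lemma absorb_gsubst (F G : GF) i j : absorbs F j -> (j <= i)%N ->
  F * gsubst G (p ^+ i) = aug G *: F.
Proof.
move=> h ji; apply: padicGF_eq => k; rewrite gphiM gphi_gsubst gphiZ.
rewrite (augE G k) scaler_suml mulr_sumr; apply: eq_bigr => A _.
by rewrite -scalerAr (absorbsP h).
Qed.

Lemma absorbs_zcoset c j : absorbs (zcoset C pi c j) j.
Proof.
move=> k t; rewrite /= /zfam -scalerAl mulr_suml; congr (_ *: _).
pose D := cls pi k (p ^+ j * t).
rewrite [RHS](reindex_inj (addIr D)) /=; apply: eq_big => [B|B _]; last first.
  by rewrite gammaD.
have tr (E : Rk pi k) y : meets (pcoset pi c j) E ->
    meets (pcoset pi c j) (E + cls pi k (p ^+ j * y)).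
  move=> /Defs.meetsP[_ [x ->] <-]; apply/Defs.meetsP.
  exists (c + p ^+ j * (x + y)); first by exists (x + y).
  by rewrite mulrDr addrA [LHS]clsD.
apply/idP/idP => [h|h]; first exact: tr.
by have := tr _ (- t) h; rewrite mulrN -addrA -clsD subrr cls0 addr0.
Qed.

(** Each projection of [zcoset] is a mean of classes of c + pi^i x, all of which act on [F] as the
    class of [c]. *)
Lemma absorb_zcoset (F : GF) c i j : absorbs F j -> (j <= i)%N ->
  F * zcoset C pi c i = F * zpt C pi c.
Proof.
move=> h ji; apply: padicGF_eq => k; rewrite !gphiM gphi_zpt /= /zfam.
rewrite -scalerAr mulr_sumr.
rewrite (eq_bigr (fun=> gphi F k * gamma C (cls pi k c))) => [|B]; last first.
  move=> /Defs.meetsP[_ [x ->] <-].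
  by rewrite addrC clsD gammaD mulrA (absorbsP h).
rewrite sumr_const -scaler_nat scalerA mulVf ?scale1r // pnatr_eq0 -lt0n.
apply/card_gt0P; exists (cls pi k c); apply/Defs.meetsP; exists c => //.
by exists 0; rewrite mulr0 addr0.
Qed.

Lemma vr_val_eqP (a : R) n : vr_val_eq a n ->
  exists2 u : R, u \is a GRing.unit & a = p ^+ n * u.
Proof.
move=> [a0 va]; have /pidealP[u e] : a \in pideal pi n.
  by rewrite pideal_valE /val_ge va lexx orbT.
exists u => //; move: a0 va; rewrite e vr_valM mulf_eq0 negb_or => /andP[h u0].
rewrite pvalM // unifX_val => /eqP; rewrite -subr_eq0 addrAC subrr add0r => v0.
by rewrite unfold_in /= /vr_unit u0.
Qed.

(** Compute the product of [zcoset] and the generating function of ax in two ways. The latter is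
    invariant under pi^lam R, so the coset may be replaced by the point [c]. It is also a
    substitution at pi^lam of total mass 1, so [zcoset] absorbs it. *)
Lemma genfun_linear m (a : R) (x : 'I_m) c lam : vr_val_eq a lam ->
  zpt C pi c * genfun C pi (a *: 'X_x) = zcoset C pi c lam.
Proof.
move=> /vr_val_eqP[u uu ea]; have [w wu] : exists w, u * w = 1.
  by exists u^-1; rewrite mulrV.
have ev k (A : {ffun 'I_m -> Rk pi k}) : evalk (a *: 'X_x) A = mulk a (A x).
  by rewrite /evalk mevalZ mevalXU.
have absL : absorbs (genfun C pi (a *: 'X_x)) lam.
  move=> k t; rewrite gphi_genfun -scalerAl mulr_suml; congr (_ *: _).
  (* As [w] is the inverse of [u], shifting x by w t shifts ax by pi^lam t. *)
  pose D : {ffun 'I_m -> Rk pi k} := [ffun=> cls pi k (w * t)].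
  rewrite [RHS](reindex_inj (addIr D)) /=; apply: eq_bigr => A _.
  rewrite !ev !ffunE mulkD gammaD mulk_cls ea; congr (_ * gamma C (cls _ _ _)).
  by rewrite -mulrA [u * _]mulrA wu mul1r.
rewrite mulrC -(absorb_zcoset _ absL (leqnn _)) mulrC.
have -> : a *: 'X_x = p ^+ lam *: (u *: 'X_x) by rewrite scalerA ea.
rewrite -gsubst_genfun (absorb_gsubst _ (@absorbs_zcoset c lam) (leqnn lam)).
by rewrite aug_genfun scale1r.
Qed.

End Absorption.

(** * Expansion and direct sums of quadratic forms *)

Section QuadraticForms.
Variable R : comNzRingType.

Lemma qform_meval n (M : 'M[R]_n) x :
  (qform M).@[x] = \sum_i \sum_j M i j * (x i * x j).
Proof.
rewrite /qform raddf_sum; apply: eq_bigr => i _; rewrite raddf_sum.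
by apply: eq_bigr => j _; rewrite /= mevalZ mevalM !mevalXU.
Qed.

Lemma qform_mevalZ n (M : 'M[R]_n) s x :
  (qform M).@[fun i => s * x i] = s ^+ 2 * (qform M).@[x].
Proof.
rewrite !qform_meval mulr_sumr; apply: eq_bigr => i _; rewrite mulr_sumr.
by apply: eq_bigr => j _; ring.
Qed.

(** Symmetry of [M] makes the two cross terms equal; the resulting factor 2 is where [ell]
    enters. *)
Lemma qform_mevalD n (M : 'M[R]_n) s x h : M^T = M ->
  (qform M).@[fun i => x i + s * h i] =
  (qform M).@[x] + 2 * s * (\sum_i (\sum_j M i j * x j) * h i)
  + s ^+ 2 * (qform M).@[h].
Proof.
move=> sM; rewrite -qform_mevalZ !qform_meval.
have e1 : s * \sum_i (\sum_j M i j * x j) * h i =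
    \sum_i \sum_j M i j * ((s * h i) * x j).
  rewrite mulr_sumr; apply: eq_bigr => i _; rewrite mulr_suml mulr_sumr.
  by apply: eq_bigr => j _; ring.
have e2 : s * \sum_i (\sum_j M i j * x j) * h i =
    \sum_i \sum_j M i j * (x i * (s * h j)).
  rewrite e1 exchange_big; apply: eq_bigr => i _; apply: eq_bigr => j _ /=.
  by rewrite -[in LHS]sM mxE; ring.
rewrite -mulrA mulr_natl mulr2n {1}e1 e2 -!big_split; apply: eq_bigr => i _.
by rewrite /= -!big_split; apply: eq_bigr => j _ /=; ring.
Qed.

Lemma qform_dsum n m (M : 'M[R]_n) (N : 'M[R]_m) :
  dpol (dsum (DPoly (qform M)) (DPoly (qform N))) = qform (block_mx M 0 0 N).
Proof.
have e k l (A : 'M[R]_k) (t : 'I_k -> 'I_l) :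
    qform A \mPo [tuple 'X_(t i) | i < k] =
    \sum_i \sum_j A i j *: ('X_(t i) * 'X_(t j)).
  rewrite /qform raddf_sum; apply: eq_bigr => i _ /=.
  rewrite raddf_sum; apply: eq_bigr => j _ /=.
  by rewrite comp_mpolyZ rmorphM /= !comp_mpolyXU -!tnth_nth !tnth_mktuple.
rewrite /= !e /qform big_split_ord /=; congr (_ + _); apply: eq_bigr => i _.
  rewrite big_split_ord /= [X in _ = _ + X]big1 ?addr0 => [|j _].
    by apply: eq_bigr => j _; rewrite block_mxEul.
  by rewrite block_mxEur mxE scale0r.
rewrite big_split_ord /= [X in _ = X + _]big1 ?add0r => [|j _].
  by apply: eq_bigr => j _; rewrite block_mxEdr.
by rewrite block_mxEdl mxE scale0r.
Qed.

End QuadraticForms.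

Lemma unimodular_dsum (R : comUnitRingType) (P S : dpoly R) :
  unimodular_qform (dpol P) -> unimodular_qform (dpol S) ->
  unimodular_qform (dpol (dsum P S)).
Proof.
case: P S => [n f] [m g] [M [sM uM /= ->]] [N [sN uN /= ->]].
exists (block_mx M 0 0 N); split; last exact: (qform_dsum M N).
  by rewrite tr_block_mx sM sN !trmx0.
by rewrite det_ublock unitrM uM.
Qed.

Lemma unimodular_dzero (R : comUnitRingType) :
  unimodular_qform (dpol (@dzero R)).
Proof.
exists 1%:M; split; first exact: trmx1.
  by rewrite det1 unitr1.
by rewrite /qform big_ord0.
Qed.

(** For each fixed [B], translation by [tau B] permutes the points satisfying [P]. The inner sum can
    then be evaluated one [A] at a time. *)
Lemma sum_average (I : finType) (U : finZmodType) (V : nmodType)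
    (P : pred {ffun I -> U}) (F : {ffun I -> U} -> V)
    (tau : {ffun I -> U} -> {ffun I -> U}) :
  (forall A B, P (A + tau B) = P A) ->
  (\sum_(A | P A) F A) *+ #|{ffun I -> U}| = \sum_(A | P A) \sum_B F (A + tau B).
Proof.
move=> hP; rewrite exchange_big -sumr_const; apply: eq_bigr => B _ /=.
by rewrite (reindex_inj (addIr (tau B))) /=; apply: eq_bigl => A.
Qed.

(** * Splitting off the head, and its translation invariance *)

Section Heads.
Variables (C : numFieldType) (K : padicField) (pi : uniformizer K).
Local Notation R := (vring K).
Local Notation GF := (padicGF C pi).
Local Notation q := (resq pi).
Local Notation p := (unif pi).

Definition mulkX (s : R) n k (A : {ffun 'I_n -> Rk pi k}) :
  {ffun 'I_n -> Rk pi k} := [ffun i => mulk s (A i)].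

Lemma evalkE n (f : {mpoly R[n]}) k (A : {ffun 'I_n -> Rk pi k}) (x : 'I_n -> R) :
  (forall i, cls pi k (x i) = A i) -> evalk f A = cls pi k f.@[x].
Proof. by move=> h; apply: meval_congr_cls => i; rewrite repK h. Qed.

Lemma primitiveD n k (A B : {ffun 'I_n -> Rk pi k.+1}) (s : R) :
  s \in pideal pi 1 -> primitive (A + mulkX s B) = primitive A.
Proof.
move=> ps; apply: eq_existsb => i; rewrite !ffunE RredD //.
rewrite [Rred 1 (mulk s _)]Rred_cls // (_ : cls pi 1 _ = 0) ?addr0 //.
by rewrite -(cls0 pi 1); apply/clsP; rewrite subr0 pidealMr.
Qed.

(** The nonprimitive vectors form the kernel of reduction modulo pi; each further level multiplies
    their number by q^n. *)
Lemma card_nonprimitive n k :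
  #|[pred A : {ffun 'I_n -> Rk pi k.+1} | ~~ primitive A]| = (q ^ (n * k))%N.
Proof.
have npE j (A : {ffun 'I_n -> Rk pi j}) :
    ~~ primitive A = ([ffun i => Rred 1 (A i)] == 0).
  apply/existsPn/eqP => [h|/ffunP h i].
    by apply/ffunP => i; rewrite !ffunE; apply/eqP; rewrite -[_ == _]negbK h.
  by have := h i; rewrite !ffunE => ->; rewrite eqxx.
elim: k => [|k IH].
  rewrite muln0 expn0 -[RHS](card1 (0 : {ffun 'I_n -> Rk pi 1})); apply: eq_card => A.
  rewrite !inE npE; congr (_ == _); apply/ffunP => i; rewrite ffunE.
  exact: Rred_id.
pose rv (A : {ffun 'I_n -> Rk pi k.+2}) := [ffun i => Rred k.+1 (A i)].
have rvE A : primitive (rv A) = primitive A.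
  by apply: eq_existsb => i; rewrite ffunE Rred_trans.
rewrite -sum1_card.
rewrite (partition_big rv (fun A => ~~ primitive A)) => [|A]; last first.
  by rewrite inE rvE.
rewrite mulnS addnC expnD -IH -sum_nat_const; apply: eq_bigr => B hB.
rewrite sum1_card -(Rred_fibreX B); apply: eq_card => A; rewrite !inE.
by rewrite unfold_in inE -rvE -/(rv A); case: eqP => [->|]; rewrite ?hB ?andbF.
Qed.

Lemma genfun_head n (f : {mpoly R[n]}) :
  (forall x, f.@[fun i => p * x i] = p ^+ 2 * f.@[x]) ->
  genfun C pi f =
  genhead C pi f + q%:R ^- n *: gsubst (genfun C pi f) (p ^+ 2).
Proof.
move=> hf; apply: padicGF_eqS => k.
rewrite gphiD gphiZ gphi_gsubst gphi_genhead !gphi_genfun [gpush _ _]linearZ.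
rewrite /= [gpush _ _]linear_sum /=.
rewrite [in LHS](bigID (@primitive _ pi n k.+1)) scalerDr /=; congr (_ + _).
set S0 := \sum_(i | ~~ _) _; set S2 := \sum_i _.
have q0 m : q%:R ^+ m != 0 :> C by rewrite expf_neq0 // resq_neq0.
(* Average [S0] over translations by multiples of [p]: each of the q^(nk) nonprimitive vectors then
   contributes the full sum [S2]. *)
have avg : q%:R ^+ (n * k.+1) *: S0 = q%:R ^+ (n * k) *: S2.
  rewrite -!natrX !scaler_nat -card_RkX /S0.
  rewrite (@sum_average _ _ _ _ _ (@mulkX p n k.+1)) => [|A B]; last first.
    by rewrite primitiveD //; apply/pidealP; exists 1; rewrite expr1 mulr1.
  rewrite (eq_bigr (fun=> S2)) => [|A nA].
    rewrite sumr_const; congr (_ *+ _); exact: card_nonprimitive.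
  have /fin_all_exists[a ha] : forall i, exists a : R, A i = cls pi k.+1 (p * a).
    move=> i; have /pidealP[a ea] : rep (A i) \in pideal pi 1.
      rewrite -[rep _]subr0; apply/clsP; rewrite cls0 -[LHS]/(Rred 1 (A i)).
      by move/existsPn: nA => /(_ i); rewrite negbK => /eqP.
    by exists a; rewrite -(repK (A i)) ea expr1.
  (* A quotient of [A] by [p] is not unique, but the choice only shifts the summation over [B]. *)
  pose A' : {ffun 'I_n -> Rk pi k.+1} := [ffun i => cls pi k.+1 (a i)].
  rewrite [RHS](reindex_inj (addrI A')) /=; apply: eq_bigr => B _.
  rewrite gpush_gamma /evalk mulk_cls -hf; congr gamma; apply: evalkE => i.
  by rewrite -mulk_cls repK !ffunE mulkD mulk_cls ha.
apply: (scalerI (q0 (n * k.+1)%N)); rewrite scalerA mulfV // scale1r.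
apply: (scalerI (q0 (n * k.+1)%N)); rewrite avg !scalerA; congr (_ *: _).
rewrite mulrAC mulfK // mulnS exprD.
by rewrite mulrAC mulfV // mul1r.
Qed.

Lemma unit_pideal (x : R) : (x \is a GRing.unit) = (x \notin pideal pi 1).
Proof.
rewrite pideal_valE /val_ge negb_or -ltNge unfold_in /= /vr_unit.
have := vr_valP x; rewrite unfold_in /val_ge.
by case: (vr_val x == 0) => //=; case: pval => [[]|].
Qed.

Lemma unitD_pideal (x y : R) :
  x \is a GRing.unit -> y \in pideal pi 1 -> x + y \is a GRing.unit.
Proof.
rewrite !unit_pideal => hx hy; apply: contra hx => h.
by rewrite -(addrK y x) rpredB.
Qed.

Lemma pideal_unitMl (u x : R) k : u \is a GRing.unit ->
  u * x \in pideal pi k -> x \in pideal pi k.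
Proof. by move=> hu h; rewrite -(mulKr hu x) mulrC pidealMr. Qed.

(** If pi divided every entry of Mx, it would divide adj(M) M x = det(M) x, hence x. *)
Lemma unimodular_primitive n (M : 'M[R]_n) (x : 'I_n -> R) :
  \det M \is a GRing.unit -> (exists i, x i \notin pideal pi 1) ->
  exists i, \sum_j M i j * x j \is a GRing.unit.
Proof.
move=> uM [i0 hx].
have [/existsP//|/existsPn h] := boolP [exists i, \sum_j M i j * x j \is a GRing.unit].
case/negP: hx; apply: (pideal_unitMl uM).
pose X : 'cV[R]_n := \col_j x j.
have -> : \det M * x i0 = ((\adj M *m M) *m X) i0 ord0.
  by rewrite mul_adj_mx mul_scalar_mx !mxE.
rewrite -mulmxA mxE; apply: rpred_sum => j _; rewrite mulrC; apply: pidealMr.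
have -> : (M *m X) j ord0 = \sum_l M j l * x l.
  by rewrite mxE; apply: eq_bigr => l _; rewrite mxE.
by have := h j; rewrite unit_pideal negbK.
Qed.

(** A Hensel-type argument: near a primitive point some partial derivative is 2 times a unit, so
    moving the point by multiples of pi^(ell+1) spreads the values of [f] uniformly over a coset of
    pi^(2 ell + 1) R. *)
Lemma absorbs_genhead n (f : {mpoly R[n]}) ell :
  vr_val_eq (2 : R) ell -> unimodular_qform f ->
  absorbs (genhead C pi f) (2 * ell).+1.
Proof.
move=> /(vr_val_eqP pi)[u uu e2] [M [sM uM ef]] [|k] t.
  rewrite (_ : cls pi 0 _ = 0) ?mulr1 //; rewrite -(cls0 pi 0).
  apply/clsP/pidealP; exists (p ^+ (2 * ell).+1 * t - 0).
  by rewrite expr0 mul1r.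
rewrite gphi_genhead -scalerAl; congr (_ *: _).
set S := \sum_(A | _) _; set D := gamma C _.
have N0 : #|{ffun 'I_n -> Rk pi k.+1}|%:R != 0 :> C.
  by rewrite card_RkX pnatr_eq0 -lt0n expn_gt0 resq_gt0.
apply: (scalerI N0); rewrite scalerAl !scaler_nat.
(* With this step the linear term carries 2e, of valuation 2 ell + 1, and the quadratic term e^2, of
   valuation 2 ell + 2, strictly larger. *)
pose e : R := p ^+ ell.+1.
rewrite /S (@sum_average _ _ _ _ _ (@mulkX e n k.+1)) => [|A B]; last first.
  by rewrite primitiveD //; apply/pidealP; exists (p ^+ ell); rewrite expr1 -exprS.
rewrite mulr_suml; apply: eq_bigr => A pA.
pose x i := rep (A i).
have [i0 ui0] : exists i, \sum_j M i j * x j \is a GRing.unit.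
  apply: unimodular_primitive => //; case/existsP: pA => i hi; exists i.
  apply: contra hi; rewrite -[x i]subr0 => /clsP; rewrite cls0 => h.
  by apply/eqP; rewrite -h.
(* [f(x + e h) = f(x) + P g(h)], and [g] is affine with unit slope modulo [pi] in
   the coordinate [i0], so replacing that coordinate by [g(h)] permutes the [h]. *)
pose g (h : 'I_n -> R) := u * (\sum_i (\sum_j M i j * x j) * h i) + p * f.@[h].
pose P := p ^+ (2 * ell).+1.
have evE B : evalk f (A + mulkX e B) =
    evalk f A + mulk P (cls pi k.+1 (g (fun i => rep (B i)))).
  rewrite (@evalkE _ _ _ _ (fun i => x i + e * rep (B i))) => [|i]; last first.
    by rewrite clsD !ffunE repK.
  rewrite mulk_cls /evalk -clsD ef qform_mevalD // /g -addrA; congr (cls _ _ (_ + _)).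
  rewrite mulrDr ef -/x; congr (_ + _).
    rewrite e2 /P /e mulrA; congr (_ * _).
    by rewrite mul2n -addnn -addnS exprD; ring.
  have -> : e ^+ 2 = P * p by rewrite /P /e -exprM -exprSr mulSn [(2 * _)%N]mulnC.
  by rewrite mulrA.
pose Phi (B : {ffun 'I_n -> Rk pi k.+1}) : {ffun 'I_n -> Rk pi k.+1} :=
  [ffun i => if i == i0 then cls pi k.+1 (g (fun i => rep (B i))) else B i].
have PhiI : injective Phi.
  move=> B B' /ffunP eB.
  have eB' i : i != i0 -> B i = B' i.
    by move=> /negPf h; have := eB i; rewrite !ffunE h.
  apply/ffunP => i; have [->|/eB'//] := eqVneq i i0.
  pose d := rep (B i0) - rep (B' i0).
  pose dl (i : 'I_n) : R := (i == i0)%:R.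
  have eh i1 : rep (B i1) = rep (B' i1) + d * dl i1.
    rewrite /dl; have [->|/eB' ->] := eqVneq i1 i0; last by rewrite mulr0 addr0.
    by rewrite mulr1 /d addrC subrK.
  have := eB i0; rewrite !ffunE eqxx => /clsP.
  set b' := fun i => rep (B' i).
  have -> : g (fun i => rep (B i)) = g (fun i => b' i + d * dl i).
    rewrite /g (meval_eq f eh); congr (_ * _ + _).
    by apply: eq_bigr => j _; rewrite eh.
  have lin : \sum_i (\sum_j M i j * x j) * (b' i + d * dl i) =
      \sum_i (\sum_j M i j * x j) * b' i + d * \sum_j M i0 j * x j.
    under eq_bigr => j _ do rewrite mulrDr.
    rewrite big_split /=; congr (_ + _).
    rewrite (bigD1 i0) //= [X in _ + X]big1 => [|j hj]; last first.
      by rewrite /dl (negbTE hj) !mulr0.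
    by rewrite addr0 /dl eqxx mulr1 mulrC.
  rewrite /g lin ef qform_mevalD //.
  set y0 := \sum_j M i0 j * x j; set y1 := \sum_i _; set z := \sum_i _.
  set f1 := (qform M).@[b']; set f2 := (qform M).@[dl].
  (* The cofactor of [d] is the unit [u * y0] plus a multiple of pi, hence a unit, so [d] vanishes
     modulo pi^(k+1). *)
  have -> : u * (y1 + d * y0) + p * (f1 + 2 * d * z + d ^+ 2 * f2) - (u * y1 + p * f1)
    = (u * y0 + p * (2 * z + d * f2)) * d by ring.
  move/pideal_unitMl => h; rewrite -(repK (B i0)) -(repK (B' i0)).
  apply/clsP/h; apply: unitD_pideal; first by rewrite unitrM uu.
  by apply/pidealP; exists (2 * z + d * f2); rewrite expr1.
have tE : \sum_B gamma C (evalk f (A + mulkX e B)) =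
    gamma C (evalk f A) * \sum_(B : {ffun 'I_n -> Rk pi k.+1}) gamma C (mulk P (B i0)).
  rewrite [in RHS](reindex_inj PhiI) mulr_sumr /=; apply: eq_bigr => B _.
  by rewrite evE gammaD ffunE eqxx.
rewrite tE -mulrA; congr (_ * _); rewrite mulr_suml.
(* Coordinate [i0] now runs freely, so a shift by [t] absorbs the factor [D]. *)
pose T : {ffun 'I_n -> Rk pi k.+1} := [ffun=> cls pi k.+1 t].
rewrite [RHS](reindex_inj (addIr T)) /=; apply: eq_bigr => B _.
by rewrite !ffunE mulkD gammaD mulk_cls.
Qed.

End Heads.

(** * The recursion along the diagonal decomposition *)

Section Recursion.
Variables (C : numFieldType) (K : padicField) (pi : uniformizer K).
Local Notation R := (vring K).
Local Notation GF := (padicGF C pi).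
Local Notation q := (resq pi).
Local Notation p := (unif pi).

Variables (ell : nat) (hell : vr_val_eq (2 : R) ell).
Variables (r : nat -> nat) (Q : forall i, {mpoly R[r i]}).
Hypothesis hQ : forall i, unimodular_qform (Q i).

Local Notation G P := (genfun C pi (dpol P)).
Local Notation H P := (genhead C pi (dpol P)).
Local Notation Qp i := (Qpar Q i).
Local Notation w i := (((qpar r q i)%:R)^-1 : C).
Local Notation gi j := (gsubst (G (DPoly (Q j))) (p ^+ j)).
Local Notation Gi i := (gsubst (G (Qp i)) (p ^+ i)).
Local Notation HG i := (gsubst (H (Qp i)) (p ^+ i)
    * gsubst (G (Qp i.+1)) (p ^+ i.+1)
    * \prod_(2 <= j < (2 * ell).+1) gsubst (G (DPoly (Q (i + j)%N))) (p ^+ (i + j))).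

Lemma genfun_big (I : Type) (s : seq I) (P : pred I) (F : I -> dpoly R) :
  G (\big[dsum/dzero]_(i <- s | P i) F i) = \prod_(i <- s | P i) G (F i).
Proof.
apply: (big_morph (fun S => G S) (@genfun_dsum C K pi)).
exact: (genfun0 C pi 0).
Qed.

Lemma dvars_Qpar i : dvars (Qp i) = rpar r i.
Proof. exact: (big_morph (@dvars R)). Qed.

Lemma unimodular_Qpar i : unimodular_qform (dpol (Qp i)).
Proof.
apply: (big_ind (fun S => unimodular_qform (dpol S))) => [|P S|j _].
- exact: unimodular_dzero.
- exact: unimodular_dsum.
- exact: hQ.
Qed.

Lemma genfun_Qpar0 : G (Qp 0) = G (DPoly (Q 0%N)).
Proof. by rewrite genfun_big big_mkcond big_nat1. Qed.

Lemma genfun_Qpar1 : G (Qp 1) = G (DPoly (Q 1%N)).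
Proof. by rewrite genfun_big big_mkcond !big_nat_recr //= big_nil !mul1r. Qed.

Lemma genfun_QparSS i : G (Qp i.+2) = G (Qp i) * G (DPoly (Q i.+2)).
Proof.
rewrite !genfun_big big_mkcond 2?[in LHS]big_nat_recr //= negbK eqxx.
by rewrite [in RHS]big_mkcond; case: (odd i); rewrite mulr1.
Qed.

Lemma absorb_prod (F : GF) a b j : absorbs F j -> (j <= a)%N ->
  F * \prod_(a <= l < b) gi l = F.
Proof.
move=> h ja; rewrite big_nat; elim/big_rec: _ => [|l x /andP[al _] IH].
  by rewrite mulr1.
by rewrite mulrA (absorb_gsubst _ h (leq_trans ja al)) aug_genfun scale1r.
Qed.

(** Substituting pi^2 after pi^i moves the remainder to pi^(i+2), exactly where Q_(i+2) can be
    adjoined. *)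
Lemma Gpar_head i : Gi i =
  gsubst (H (Qp i)) (p ^+ i) + q%:R ^- rpar r i *: gsubst (G (Qp i)) (p ^+ i.+2).
Proof.
have [M [_ _ eM]] := unimodular_Qpar i.
rewrite {1}(@genfun_head C _ pi _ (dpol (Qp i))) => [|x].
  by rewrite gsubstD gsubstZ gsubst_comp -exprD addn2 -dvars_Qpar.
by rewrite eM qform_mevalZ.
Qed.

(** The cutoff [N] keeps the product finite. Factors beyond [omega] equal 1, so [N] may be taken as
    large as the recursion requires. *)
Definition partial_genfun N i : GF := Gi i * Gi i.+1 * \prod_(i.+2 <= j < N) gi j.

Lemma partial_genfun0 N : (1 < N)%N ->
  partial_genfun N 0 = \prod_(0 <= j < N) gi j.
Proof.
move=> N1; rewrite [RHS]big_ltn ?(ltnW N1) // [in RHS]big_ltn // mulrA.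
by rewrite /partial_genfun genfun_Qpar0 genfun_Qpar1.
Qed.

(** The head absorbs all factors of index at least i + 2 ell + 1, leaving [HG i]. In the remainder,
    [genfun_QparSS] merges the factor of index i+2 with the shifted one. *)
Lemma partial_genfunS N i : (i + (2 * ell).+3 <= N)%N ->
  partial_genfun N i = HG i + q%:R ^- rpar r i *: partial_genfun N i.+1.
Proof.
move=> iN; rewrite /partial_genfun {1}Gpar_head !mulrDl -!scalerAl.
congr (_ + _ *: _).
  have ab : absorbs (gsubst (H (Qp i)) (p ^+ i)) (i + (2 * ell).+1).
    by apply: absorbs_gsubst; apply: absorbs_genhead (unimodular_Qpar i).
  have e : \prod_(2 <= j < (2 * ell).+1) gi (i + j)%N =
      \prod_(i.+2 <= j < i + (2 * ell).+1) gi j.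
    rewrite -[i.+2]add2n big_addn addKn; apply: eq_bigr => j _.
    by rewrite addnC.
  (* For [ell = 0] the bound i + 2 ell + 1 lies below the first index i+2, so the product cannot be
     cut there; it is absorbed whole. *)
  rewrite e; have [l0|l0] := posnP ell.
    rewrite [in RHS]big_geq ?l0 ?addn1 // mulr1; apply: absorb_prod.
      exact: absorbsMr ab.
    by rewrite l0 addn1.
  rewrite (@big_cat_nat _ _ _ (i + (2 * ell).+1)) /=; last 2 first.
  - by rewrite -addn2 leq_add2l ltnS -[1%N]/(2 * 0).+1 ltn_mul2l.
  - by apply: leq_trans iN; rewrite leq_add2l ltnS leqW.
  by rewrite mulrA; apply: absorb_prod (leqnn _); do 2!apply: absorbsMr.
rewrite big_ltn; last by apply: leq_trans iN; rewrite -addn3 leq_add2l.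
rewrite genfun_QparSS gsubstM !mulrA; congr (_ * _ * _).
by rewrite mulrC.
Qed.

Lemma qparS i : w i.+1 = w i * q%:R ^- rpar r i.
Proof. by rewrite /qpar big_nat_recr //= expnD natrM natrX invfM natrX. Qed.

(** The prefactor [z] is left free so as to serve both for a point and for a coset. *)
Lemma mul_partial_genfun0 (z : GF) N M : (M + (2 * ell).+2 <= N)%N ->
  z * partial_genfun N 0 =
  \sum_(0 <= i < M) w i *: (z * HG i) + w M *: (z * partial_genfun N M).
Proof.
elim: M => [|M IH] MN.
  by rewrite big_nil add0r /qpar big_nil expn0 invr1 scale1r.
rewrite IH; last by apply: leq_trans MN; rewrite leq_add2r.
rewrite big_nat_recr //= -addrA; congr (_ + _).
rewrite partial_genfunS; last by rewrite addnS.
by rewrite mulrDr scalerDr qparS -scalerAr scalerA.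
Qed.

(** The head factor is invariant under pi^(i + 2 ell + 1) R, which here contains pi^lam R. *)
Lemma zcoset_HG c lam i : (i + 2 * ell < lam)%N ->
  zcoset C pi c lam * HG i = zpt C pi c * HG i.
Proof.
move=> il; rewrite ![_ * HG i]mulrC.
apply: (@absorb_zcoset _ _ _ _ _ _ (i + (2 * ell).+1)).
  do 2!apply: absorbsMr; apply: absorbs_gsubst.
  exact: absorbs_genhead (unimodular_Qpar i).
by rewrite addnS.
Qed.

(** All factors are substitutions at powers pi^j with j at least [lam], of total mass 1. *)
Lemma zcoset_partial_genfun c lam N :
  zcoset C pi c lam * partial_genfun N lam = zcoset C pi c lam.
Proof.
have ab : absorbs (zcoset C pi c lam) lam := @absorbs_zcoset C K pi c lam.
rewrite /partial_genfun !mulrA (absorb_gsubst _ ab (leqnn _)) aug_genfun scale1r.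
rewrite (absorb_gsubst _ ab (leqnSn _)) aug_genfun scale1r.
exact: (absorb_prod _ ab (leq_trans (leqnSn _) (leqnSn _))).
Qed.

Variable omega : nat.
Hypothesis hQ0 : forall i, (omega < i)%N -> Q i = 0.

Lemma prod_stable a N : (omega < a)%N -> \prod_(a <= j < N) gi j = 1.
Proof.
move=> oa; rewrite big_nat big1 // => j /andP[aj _].
by rewrite /= hQ0 ?genfun0 ?gsubst1 // (leq_trans oa).
Qed.

Lemma genfun_diagonal N : (omega < N)%N ->
  G (\big[dsum/dzero]_(0 <= i < omega.+1) dscale (p ^+ i) (DPoly (Q i))) =
  \prod_(0 <= j < N) gi j.
Proof.
move=> oN; rewrite genfun_big [RHS](@big_cat_nat _ _ _ omega.+1) //=.
rewrite (prod_stable N (ltnSn omega)) mulr1; apply: eq_bigr => i _.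
by rewrite gsubst_genfun.
Qed.

Lemma partial_genfun_last N : (0 < omega)%N ->
  partial_genfun N omega.-1 = Gi omega.-1 * Gi omega.
Proof.
by move=> o0; rewrite /partial_genfun prednK // prod_stable ?mulr1.
Qed.

End Recursion.

(** * The two expansions, without and with a linear form *)

Theorem theorem4p3
  (Rr : realType) (K : padicField) (pi : uniformizer K)
  (ell : nat) (hell : vr_val_eq (2%:R : vring K) ell)
  (omega : nat) (homega : (0 < omega)%N)
  (r : nat -> nat) (Q : forall i : nat, {mpoly (vring K)[r i]})
  (hQ : forall i : nat, unimodular_qform (Q i))
  (hQ0 : forall i : nat, (omega < i)%N -> Q i = 0)
  (m : nat) (L : {mpoly (vring K)[m]}) (hL : L \is 1.-homog)
  (hL1 : forall i j : 'I_m, involves L i -> involves L j -> i = j)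
  (c : vring K) :
  let p : vring K := unif pi in
  let QQ : dpoly (vring K) :=
    daddc (dsum (\big[dsum/dzero]_(0 <= i < omega.+1) dscale (p ^+ i) (DPoly (Q i)))
                (DPoly L)) c in
  let G (P : dpoly (vring K)) : padicGF Rr[i] pi := genfun Rr[i] pi (dpol P) in
  let H (P : dpoly (vring K)) : padicGF Rr[i] pi := genhead Rr[i] pi (dpol P) in
  let w (i : nat) : Rr[i] := ((qpar r (resq pi) i)%:R)^-1 in
  let HG (i : nat) : padicGF Rr[i] pi :=
    gsubst (H (Qpar Q i)) (p ^+ i)
    * gsubst (G (Qpar Q i.+1)) (p ^+ i.+1)
    * \prod_(2 <= j < (2 * ell).+1) gsubst (G (DPoly (Q (i + j)%N))) (p ^+ (i + j)) in
  (L = 0 ->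
     G QQ = \sum_(0 <= i < omega.-1) w i *: (zpt Rr[i] pi c * HG i)
            + w omega.-1 *: (zpt Rr[i] pi c
                             * gsubst (G (Qpar Q omega.-1)) (p ^+ omega.-1)
                             * gsubst (G (Qpar Q omega)) (p ^+ omega)))
  /\
  (forall (a : vring K) (x : 'I_m) (lam : nat),
     L = a *: 'X_x -> vr_val_eq a lam ->
     G QQ = \sum_(0 <= i < lam - 2 * ell) w i *: (zpt Rr[i] pi c * HG i)
            + \sum_(maxn 0 (lam - 2 * ell) <= i < lam)
                w i *: (zcoset Rr[i] pi c lam * HG i)
            + w lam *: zcoset Rr[i] pi c lam).
Proof.
move=> p QQ G H w HG.
have GQ N : (1 < N)%N -> (omega < N)%N ->
    G QQ = zpt Rr[i] pi c * genfun Rr[i] pi L * partial_genfun Rr[i] pi Q N 0.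
  move=> N1 oN; rewrite /G genfun_daddc genfun_dsum (genfun_diagonal _ _ hQ0 oN) /=.
  by rewrite partial_genfun0 // -mulrA; congr (_ * _); rewrite mulrC.
split=> [L0|a x lam eL va].
  pose N := (omega.+1 + (2 * ell).+2)%N.
  rewrite (GQ N) ?leq_addr //; last by rewrite /N addnS.
  rewrite L0 genfun0 mulr1 (mul_partial_genfun0 hell hQ _ (M := omega.-1)).
    by rewrite (partial_genfun_last _ _ hQ0 _ homega) mulrA.
  by rewrite leq_add2r (leq_trans (leq_pred _)).
(* Beyond [omega] for the diagonal product, and large enough for [lam] steps of the recursion. *)
pose N := (omega.+1 + lam + (2 * ell).+2)%N.
rewrite (GQ N); last 2 first.
- by rewrite /N addnS !addSn.
- by rewrite /N -addnA leq_addr.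
rewrite eL (genfun_linear _ _ _ _ va).
rewrite (mul_partial_genfun0 hell hQ _ (M := lam)); last first.
  by rewrite leq_add2r leq_addl.
rewrite zcoset_partial_genfun max0n; congr (_ + _).
(* Below this index the coset may be replaced by the point [c]. The subtraction truncates at 0, so
   that range is empty when [lam] is at most 2 ell. *)
rewrite (@big_cat_nat _ _ _ (lam - 2 * ell)) ?leq_subr //=; congr (_ + _).
apply: eq_big_nat => i /andP[_ il]; congr (_ *: _); apply: zcoset_HG => //.
by rewrite addnC -ltn_subRL.
Qed.
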